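(* For each dynamical diagram \(D\) there is a geometrically fast set \(X_D\subseteq \operatorname{PL}_+(I)\) such that whenever \(X\subseteq\operatorname{Homeo}_+(I)\) is geometrically fast, has finitely many transition points, and has dynamical diagram isomorphic to \(D\), there are a marked isomorphism \(\phi:\langle X\rangle\to\langle X_D\rangle\) and a continuous order preserving surjection \(\hat\theta: I\to I\) such that \(x f\hat\theta = x\hat\theta\,\phi(f)\) for all \(f\in\langle X\rangle\) and \(x\in I\).
   Context: \(I=[0,1]\); \(\operatorname{Homeo}_+(I)\) is the group of orientation preserving homeomorphisms of \(I\) acting on the right (\(tg\) is the image of \(t\), \(fg\) means apply \(f\) first), and \(\operatorname{PL}_+(I)\) its subgroup of piecewise linear elements. The support of \(f\) is \(\operatorname{supt}(f)=\{t : tf\neq t\}\); orbitals are its components. A left (right) transition point of \(f\) is \(t\notin\operatorname{supt}(f)\) with \((t,t+\epsilon)\cap\operatorname{supt}(f)\ne\emptyset\) (resp. \((t-\epsilon,t)\cap\operatorname{supt}(f)\neq\emptyset\)) for all \(\epsilon>0\). A bump is an element with exactly one orbital, positive if \(ta>t\) on its support; \(b\) is a signed bump of \(f\) if \(b\) agrees with \(f\) on \(\operatorname{supt}(b)\); a positive bump \(a\) is used in \(X\) if some \(f\in X\) agrees with \(a\) or \(a^{-1}\) on \(\operatorname{supt}(a)\). \(X\) is geometrically proper if no point is a left transition point of two distinct elements of \(X\) or a right transition point of two distinct elements of \(X\). A marking of a set \(A\) of positive bumps assigns each \(a\) a marker \(t\in\operatorname{supt}(a)\); for \(a\) with orbital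 \((x,y)\), \(\operatorname{src}(a)=(x,t)\), \(\operatorname{dest}(a)=[ta,y)\), \(\operatorname{src}(a^{-1})=\operatorname{dest}(a)\), \(\operatorname{dest}(a^{-1})=\operatorname{src}(a)\) (the feet). \(A\) is geometrically fast if geometrically proper and some marking makes all feet pairwise disjoint; \(X\) is geometrically fast if it is geometrically proper and the set of bumps used in \(X\) is geometrically fast. A dynamical diagram is a finite directed graph with edge labels and a linear order on its vertices in which every vertex has total degree 1. The dynamical diagram of a geometrically fast \(X\) with finitely many transition points has as vertices the feet (of a marking with disjoint feet), ordered as in \(I\), as edges the signed bumps of elements of \(X\) directed from source to destination, labeled by the element of \(X\) they come from; isomorphisms are order preserving directed graph isomorphisms inducing a bijection of labels. For finite geometrically proper sets, enumerate each in increasing order of least transition points; \(\phi:\langle X\rangle\to\langle Y\rangle\) is a marked isomorphism if it is an isomorphism sending the \(i\)-th element of \(X\) to the \(i\)-th element of \(Y\) for each \(i\). *)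

(* Defs.v *)
From Stdlib Require Import Reals Lra Lia List ClassicalEpsilon.
Open Scope R_scope.

(** * Homeomorphisms of I = [0,1]
    An element of Homeo_+(I) is encoded as a function R -> R that is an
    orientation preserving homeomorphism of [0,1] and the identity outside
    [0,1] (so that Leibniz equality of functions is equality of homeos). *)

Definition inI (t : R) : Prop := 0 <= t <= 1.

Definition cont_on_I (f : R -> R) : Prop :=
  forall x, inI x -> forall eps, eps > 0 -> exists delta, delta > 0 /\
    forall y, inI y -> Rabs (y - x) < delta -> Rabs (f y - f x) < eps.

Definition homeo (f : R -> R) : Prop :=
  f 0 = 0 /\ f 1 = 1 /\
  (forall s t, inI s -> inI t -> s < t -> f s < f t) /\
  cont_on_I f /\
  (forall t, ~ inI t -> f t = t).

Definition PL (f : R -> R) : Prop :=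
  exists (n : nat) (p : nat -> R),
    p 0%nat = 0 /\ p n = 1 /\
    (forall i, (i < n)%nat -> p i < p (S i)) /\
    (forall i, (i < n)%nat -> exists a b, forall t, p i <= t <= p (S i) -> f t = a * t + b).

Definition PL_homeo (f : R -> R) : Prop := homeo f /\ PL f.

(** Group operations (right action: [mul f g] means "apply f first, then g"). *)
Definition mul (f g : R -> R) : R -> R := fun t => g (f t).
Definition idf : R -> R := fun t => t.
Definition inv (f : R -> R) : R -> R :=
  fun t => epsilon (inhabits 0) (fun s => f s = t).

Inductive gen (X : (R -> R) -> Prop) : (R -> R) -> Prop :=
| gen_id : gen X idf
| gen_base : forall f, X f -> gen X f
| gen_inv : forall f, gen X f -> gen X (inv f)
| gen_mul : forall f g, gen X f -> gen X g -> gen X (mul f g).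

Definition supt (f : R -> R) (t : R) : Prop := f t <> t.

Definition left_tp (f : R -> R) (t : R) : Prop :=
  ~ supt f t /\ forall eps, eps > 0 -> exists s, t < s < t + eps /\ supt f s.

Definition right_tp (f : R -> R) (t : R) : Prop :=
  ~ supt f t /\ forall eps, eps > 0 -> exists s, t - eps < s < t /\ supt f s.

Definition tp (f : R -> R) (t : R) : Prop := left_tp f t \/ right_tp f t.

Definition finite_tp (X : (R -> R) -> Prop) : Prop :=
  exists l : list R, forall f t, X f -> tp f t -> In t l.

Definition bump (a : R -> R) : Prop :=
  homeo a /\ exists x y, x < y /\ forall t, supt a t <-> x < t < y.

Definition positive (a : R -> R) : Prop := forall t, supt a t -> a t > t.

Definition pos_bump (a : R -> R) : Prop := bump a /\ positive a.

Definition agree_on_supt (f b : R -> R) : Prop := forall t, supt b t -> f t = b t.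

Definition signed_bump_of (b f : R -> R) : Prop := bump b /\ agree_on_supt f b.

Definition used (X : (R -> R) -> Prop) (a : R -> R) : Prop :=
  pos_bump a /\ exists f, X f /\
    ((forall t, supt a t -> f t = a t) \/ (forall t, supt a t -> f t = inv a t)).

Definition geom_proper (X : (R -> R) -> Prop) : Prop :=
  (forall f g t, X f -> X g -> left_tp f t -> left_tp g t -> f = g) /\
  (forall f g t, X f -> X g -> right_tp f t -> right_tp g t -> f = g).

(** Markings and feet. [foot m a false] is src(a) = (x, m a),
    [foot m a true] is dest(a) = [ (m a) a, y ), where (x,y) = supt a. *)
Definition marking (A : (R -> R) -> Prop) (m : (R -> R) -> R) : Prop :=
  forall a, A a -> supt a (m a).

Definition foot (m : (R -> R) -> R) (a : R -> R) (s : bool) (t : R) : Prop :=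
  if s then supt a t /\ a (m a) <= t else supt a t /\ t < m a.

Definition feet_disjoint (A : (R -> R) -> Prop) (m : (R -> R) -> R) : Prop :=
  forall a a' s s', A a -> A a' -> (a, s) <> (a', s') ->
    forall t, ~ (foot m a s t /\ foot m a' s' t).

Definition good_marking (A : (R -> R) -> Prop) (m : (R -> R) -> R) : Prop :=
  marking A m /\ feet_disjoint A m.

Definition geom_fast_bumps (A : (R -> R) -> Prop) : Prop :=
  (forall a, A a -> pos_bump a) /\ geom_proper A /\ exists m, good_marking A m.

Definition geom_fast (X : (R -> R) -> Prop) : Prop :=
  geom_proper X /\ geom_fast_bumps (used X).

(** * Dynamical diagrams
    Up to isomorphism, the ordered vertex set is {0,...,n-1} with the order of
    nat, and edge labels are natural numbers. An edge is (source, target, label). *)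
Record diagram := Diagram { dg_n : nat; dg_edges : list (nat * nat * nat) }.

Definition is_diagram (D : diagram) : Prop :=
  (forall u v l, In (u, v, l) (dg_edges D) -> (u < dg_n D)%nat /\ (v < dg_n D)%nat) /\
  (forall v, (v < dg_n D)%nat ->
     (length (filter (fun e => Nat.eqb (fst (fst e)) v) (dg_edges D)) +
      length (filter (fun e => Nat.eqb (snd (fst e)) v) (dg_edges D)))%nat = 1%nat).

Definition foot_before (F F' : R -> Prop) : Prop :=
  forall u v, F u -> F' v -> u < v.

(** Vertices (indices) of the source / destination feet of a signed bump b:
    for b positive these are the feet (b,src),(b,dest); for b negative,
    src(b) = dest(b^-1) and dest(b) = src(b^-1). *)
Definition sb_vtx (vtx : (R -> R) -> bool -> nat) (b : R -> R) (d : bool) (n : nat) : Prop :=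
  (positive b /\ vtx b d = n) \/ (~ positive b /\ vtx (inv b) (negb d) = n).

Definition diagram_iso (X : (R -> R) -> Prop) (D : diagram) : Prop :=
  exists m, good_marking (used X) m /\
  exists (vtx : (R -> R) -> bool -> nat) (lab : (R -> R) -> nat),
    (forall a s, used X a -> (vtx a s < dg_n D)%nat) /\
    (forall a s a' s', used X a -> used X a' -> vtx a s = vtx a' s' -> a = a' /\ s = s') /\
    (forall v, (v < dg_n D)%nat -> exists a s, used X a /\ vtx a s = v) /\
    (forall a s a' s', used X a -> used X a' -> (a, s) <> (a', s') ->
       ((vtx a s < vtx a' s')%nat <-> foot_before (foot m a s) (foot m a' s'))) /\
    (* edges (signed bumps b of f in X, from src b to dest b, labelled f)
       correspond to the edges of D *)
    (forall f b, X f -> signed_bump_of b f ->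
       exists u v, sb_vtx vtx b false u /\ sb_vtx vtx b true v /\
                   In (u, v, lab f) (dg_edges D)) /\
    (forall u v l, In (u, v, l) (dg_edges D) ->
       exists f b, X f /\ signed_bump_of b f /\
         sb_vtx vtx b false u /\ sb_vtx vtx b true v /\ lab f = l) /\
    (forall f g, X f -> X g -> lab f = lab g -> f = g) /\
    (forall f, X f -> exists u v, In (u, v, lab f) (dg_edges D)).

Definition group_iso (X Y : (R -> R) -> Prop) (phi : (R -> R) -> (R -> R)) : Prop :=
  (forall f, gen X f -> gen Y (phi f)) /\
  (forall f g, gen X f -> gen X g -> phi f = phi g -> f = g) /\
  (forall h, gen Y h -> exists f, gen X f /\ phi f = h) /\
  (forall f g, gen X f -> gen X g -> phi (mul f g) = mul (phi f) (phi g)).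

Definition least_tp (f : R -> R) (t : R) : Prop :=
  tp f t /\ forall s, tp f s -> t <= s.

Definition enum_ltp (X : (R -> R) -> Prop) (l : list (R -> R)) : Prop :=
  (forall f, X f <-> In f l) /\ NoDup l /\
  forall i j, (i < j)%nat -> (j < length l)%nat ->
    exists ti tj, least_tp (nth i l idf) ti /\ least_tp (nth j l idf) tj /\ ti < tj.

Definition marked_iso (X Y : (R -> R) -> Prop) (phi : (R -> R) -> (R -> R)) : Prop :=
  group_iso X Y phi /\
  exists lx ly, enum_ltp X lx /\ enum_ltp Y ly /\ length lx = length ly /\
    forall i, (i < length lx)%nat -> phi (nth i lx idf) = nth i ly idf.

Definition cont_mono_surj (theta : R -> R) : Prop :=
  (forall x, inI x -> inI (theta x)) /\
  cont_on_I theta /\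
  (forall x y, inI x -> inI y -> x <= y -> theta x <= theta y) /\
  (forall y, inI y -> exists x, inI x /\ theta x = y).

(* Main.v *)
From Stdlib Require Import Reals Lra Lia List Bool Arith Classical ClassicalEpsilon.
From Stdlib Require Import FunctionalExtensionality PropExtensionality.
Require Import Defs.
Open Scope R_scope.

(* Write E for the map that expands each foot: on src(a) it is a, on dest(a) it is the inverse of a.
   The model X_D tiles [0,1] by the feet (with one extra cell between the feet of an isolated bump,
   which must not touch) and makes E affine with slope at least 2 on each foot. Then theta is the
   unique fixed point of the contraction sending theta, on each foot, to the inverse branch of the
   model's E applied to theta o E; the fixed point equation on the two feet of a bump is exactly
   equivariance on its whole orbital.

   The induced map of groups is injective by ping-pong. Locally an element g of <X> removes a finite
   E-address p and then adds an address q, and it does so on the whole cylinder of p. If theta o g =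
   theta, look at the left end c of an interval moved by g. Since g fixes c, one of p and q extends
   the other. If p = q then g is the identity to the right of c. Otherwise, on a whole foot, theta
   takes values in the fixed points of an affine map of slope at least 2, so it is constant there,
   which is absurd. *)

(** The record [realizes] covers both sides: every [X] with diagram [D] and the model are
    realizations of the same matching, so transition points, the enumeration and ping-pong are
    treated once for both.

    Feet are made half open by adding the left end of the source foot, which its bump fixes. A
    cylinder of addresses then contains a right neighbourhood of each of its points, and for this
    reason ping-pong is run at the left end of a moved interval.

    The bound 2 on slopes comes from the equal cells: a foot is one cell wide, and its partner
    starts at least two cells after it, because another foot lies between them or because of the
    extra cell. It gives both the contraction factor 1/2 for theta and the uniqueness of fixed
    points in ping-pong.

    The isomorphism is read off theta: the image of f is the only h in the group of X_D with theta o
    f = h o theta. Multiplicativity and surjectivity are then formal, and only injectivity needs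
    dynamics.

    A diagram as defined may have no realization, namely when two edges with the same label overlap.
    The empty set then serves as X_D. *)

(** * Monotone and continuous functions on the line *)

Definition onto (f : R -> R) : Prop := forall t, exists s, f s = t.

Lemma strict_increasing_le f : strict_increasing f -> increasing f.
Proof.
  intros H s t [h|h]; [left; auto | subst; lra].
Qed.

Lemma strict_increasing_inj f : strict_increasing f -> forall s t, f s = f t -> s = t.
Proof.
  intros H s t e. destruct (Rtotal_order s t) as [h|[h|h]]; auto; apply H in h; lra.
Qed.

Lemma strict_increasing_lt_inv f : strict_increasing f -> forall s t, f s < f t -> s < t.
Proof.
  intros H s t e. destruct (Rlt_le_dec s t) as [h|h]; auto.
  apply (strict_increasing_le f H) in h. lra.
Qed.

Lemma strict_increasing_le_inv f : strict_increasing f -> forall s t, f s <= f t -> s <= t.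
Proof.
  intros H s t e. destruct (Rle_lt_dec s t) as [h|h]; auto.
  apply H in h. lra.
Qed.

Lemma continuityE f :
  continuity f <->
  forall x eps, eps > 0 -> exists d, d > 0 /\
    forall y, Rabs (y - x) < d -> Rabs (f y - f x) < eps.
Proof.
  split.
  - intros H x eps he. destruct (H x eps he) as [d [hd Hd]].
    exists d; split; auto. intros y hy.
    destruct (Req_dec y x) as [->|ne].
    + rewrite Rminus_diag, Rabs_R0; auto.
    + apply Hd. split; auto. split; auto; exact I.
  - intros H x eps he. destruct (H x eps he) as [d [hd Hd]].
    exists d; split; auto. intros y [_ hy]. apply Hd. exact hy.
Qed.

Lemma increasing_onto_continuity f : increasing f -> onto f -> continuity f.
Proof.
  intros hm hs. apply continuityE. intros x eps he.
  destruct (hs (f x - eps / 2)) as [a ha]. destruct (hs (f x + eps / 2)) as [b hb].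
  assert (a < x).
  { destruct (Rlt_le_dec a x); auto. apply hm in r. lra. }
  assert (x < b).
  { destruct (Rlt_le_dec x b); auto. apply hm in r. lra. }
  exists (Rmin (x - a) (b - x)). split.
  { apply Rmin_pos; lra. }
  intros y hy.
  pose proof (Rmin_l (x - a) (b - x)). pose proof (Rmin_r (x - a) (b - x)).
  apply Rabs_def2 in hy.
  assert (f a <= f y) by (apply hm; lra).
  assert (f y <= f b) by (apply hm; lra).
  apply Rabs_def1; lra.
Qed.

Definition clamp (a b t : R) : R := Rmax a (Rmin b t).

Lemma clamp_mid a b t : a <= t <= b -> clamp a b t = t.
Proof. intros. unfold clamp. rewrite Rmin_right, Rmax_right; lra. Qed.

Lemma clamp_lo a b t : a <= b -> t <= a -> clamp a b t = a.
Proof. intros. unfold clamp. rewrite Rmin_right, Rmax_left; lra. Qed.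

Lemma clamp_hi a b t : a <= b -> b <= t -> clamp a b t = b.
Proof. intros. unfold clamp. rewrite Rmin_left, Rmax_right; lra. Qed.

Lemma clamp_range a b t : a <= b -> a <= clamp a b t <= b.
Proof.
  intros. unfold clamp. split; [apply Rmax_l|].
  apply Rmax_lub; auto. apply Rmin_l.
Qed.

Lemma clamp_increasing a b : increasing (clamp a b).
Proof.
  intros s t h. unfold clamp. apply Rle_max_compat_l. apply Rle_min_compat_l. auto.
Qed.

Lemma clamp_lipschitz a b s t : Rabs (clamp a b s - clamp a b t) <= Rabs (s - t).
Proof.
  unfold clamp, Rmax, Rmin.
  repeat (match goal with |- context [Rle_dec ?a ?b] =>
    lazymatch b with context [Rle_dec] => fail | _ => destruct (Rle_dec a b) end end);
  split_Rabs; lra.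
Qed.

Lemma clamp_continuity a b : continuity (clamp a b).
Proof.
  apply continuityE. intros x eps he. exists eps; split; auto.
  intros y hy. eapply Rle_lt_trans; [apply clamp_lipschitz | auto].
Qed.

Lemma intermediate_value f a b z :
  continuity f -> a <= b -> f a <= z <= f b -> exists c, a <= c <= b /\ f c = z.
Proof.
  intros hc hab [h1 h2].
  destruct (Req_dec (f a) z) as [e|n1]; [exists a; split; [lra|auto]|].
  destruct (Req_dec (f b) z) as [e|n2]; [exists b; split; [lra|auto]|].
  assert (a < b) by (destruct hab; auto; subst; lra).
  destruct (IVT (fun t => f t - z) a b) as [c [hc1 hc2]]; try lra.
  - apply continuity_minus; auto. apply continuity_const. intros ? ?; auto.
  - exists c; split; auto; lra.
Qed.

(** Agreement with a bump is only given on its open support; this carries it to the two ends of the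
    orbital. *)
Lemma continuity_agree_closure f g x y :
  continuity f -> continuity g -> x < y -> (forall t, x < t < y -> f t = g t) ->
  forall t, x <= t <= y -> f t = g t.
Proof.
  intros hf hg hxy H t ht.
  destruct (Req_dec (f t) (g t)) as [e|ne]; auto. exfalso.
  assert (hc : continuity (fun s => f s - g s)) by (apply continuity_minus; auto).
  apply continuityE with (x := t) (eps := Rabs (f t - g t)) in hc.
  2:{ apply Rabs_pos_lt. lra. }
  destruct hc as [d [hd Hd]].
  assert (exists s, x < s < y /\ Rabs (s - t) < d) as [s [hs hs']].
  { destruct (Rlt_le_dec t ((x + y) / 2)).
    - exists (t + Rmin d (y - x) / 2 / 2).
      pose proof (Rmin_l d (y - x)). pose proof (Rmin_r d (y - x)).
      assert (0 < Rmin d (y - x)) by (apply Rmin_pos; lra).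
      split; [lra|]. apply Rabs_def1; lra.
    - exists (t - Rmin d (y - x) / 2 / 2).
      pose proof (Rmin_l d (y - x)). pose proof (Rmin_r d (y - x)).
      assert (0 < Rmin d (y - x)) by (apply Rmin_pos; lra).
      split; [lra|]. apply Rabs_def1; lra. }
  specialize (Hd s hs'). rewrite (H s hs) in Hd.
  replace (g s - g s - (f t - g t)) with (- (f t - g t)) in Hd by ring.
  rewrite Rabs_Ropp in Hd. lra.
Qed.

(** * Homeomorphisms as increasing bijections of the line *)

(** Continuity is left out because it follows from monotonicity and surjectivity. Closure under
    inverse and composition then needs no epsilons. *)
Definition line_homeo (f : R -> R) : Prop :=
  strict_increasing f /\ onto f /\ forall t, ~ (0 < t < 1) -> f t = t.

Lemma line_homeo_continuity f : line_homeo f -> continuity f.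
Proof.
  intros [h1 [h2 _]]. apply increasing_onto_continuity; auto. apply strict_increasing_le; auto.
Qed.

Lemma line_homeo_homeo f : line_homeo f -> homeo f.
Proof.
  intros hf. pose proof (line_homeo_continuity f hf) as hc.
  destruct hf as [h1 [h2 h3]].
  split; [apply h3; lra|]. split; [apply h3; lra|]. split; [auto|].
  split.
  - intros x _ eps he. rewrite continuityE in hc.
    destruct (hc x eps he) as [d [hd Hd]]. exists d; split; auto.
  - intros t ht. apply h3. unfold inI in ht. lra.
Qed.

Lemma homeo_line_homeo f : homeo f -> line_homeo f.
Proof.
  intros [h0 [h1 [hm [hc ho]]]].
  assert (hin : forall t, inI t -> inI (f t)).
  { intros t [[a|a] [b|b]]; unfold inI; subst; try lra;
    assert (f 0 < f t) by (apply hm; unfold inI; lra);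
    assert (f t < f 1) by (apply hm; unfold inI; lra); lra. }
  split; [|split].
  - intros s t hst.
    destruct (classic (inI s)) as [a|a]; destruct (classic (inI t)) as [b|b].
    + auto.
    + rewrite (ho t b). apply hin in a as a'. unfold inI in *. lra.
    + rewrite (ho s a). apply hin in b as b'. unfold inI in *. lra.
    + rewrite (ho s a), (ho t b). auto.
  - intros t. destruct (classic (inI t)) as [a|a].
    2:{ exists t. auto. }
    (* Continuity is only known relative to [0,1]; precomposing with [clamp] extends the map
       continuously to the line. *)
    destruct (intermediate_value (fun s => f (clamp 0 1 s)) 0 1 t) as [c [hc1 hc2]].
    + apply continuityE. intros x eps he.
      destruct (hc (clamp 0 1 x)) with (eps := eps) as [d [hd Hd]]; auto.
      { apply clamp_range. lra. }
      exists d; split; auto. intros y hy. apply Hd.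
      * apply clamp_range; lra.
      * eapply Rle_lt_trans; [apply clamp_lipschitz|auto].
    + lra.
    + rewrite !clamp_mid by lra. rewrite h0, h1. exact a.
    + eauto.
  - intros t ht. destruct (classic (inI t)) as [a|a]; auto.
    unfold inI in a. destruct (Req_dec t 0) as [->|]; auto.
    destruct (Req_dec t 1) as [->|]; auto. lra.
Qed.

Lemma inv_right f : onto f -> forall t, f (inv f t) = t.
Proof.
  intros h t. unfold inv. apply epsilon_spec. apply h.
Qed.

Lemma inv_left f : line_homeo f -> forall t, inv f (f t) = t.
Proof.
  intros [h1 [h2 _]] t. apply (strict_increasing_inj f h1). apply inv_right; auto.
Qed.

Lemma inv_eq f : line_homeo f -> forall s t, f s = t -> inv f t = s.
Proof. intros h s t <-. apply inv_left; auto. Qed.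

Lemma line_homeo_inv f : line_homeo f -> line_homeo (inv f).
Proof.
  intros h. pose proof h as [h1 [h2 h3]]. split; [|split].
  - intros s t hst. apply (strict_increasing_lt_inv f h1). rewrite !inv_right; auto.
  - intros t. exists (f t). apply inv_left; auto.
  - intros t ht. apply inv_eq; auto.
Qed.

Lemma line_homeo_id : line_homeo idf.
Proof. split; [|split]; unfold idf; try (intros ? ? ?; auto); [intros t; eauto|auto]. Qed.

Lemma line_homeo_mul f g : line_homeo f -> line_homeo g -> line_homeo (mul f g).
Proof.
  intros [a1 [a2 a3]] [b1 [b2 b3]]. unfold mul. split; [|split].
  - intros s t h. auto.
  - intros t. destruct (b2 t) as [u hu]. destruct (a2 u) as [s hs]. exists s. congruence.
  - intros t h. rewrite a3; auto.
Qed.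

Lemma inv_inv f : line_homeo f -> inv (inv f) = f.
Proof.
  intros h. apply functional_extensionality. intros t.
  apply inv_eq; [apply line_homeo_inv; auto | apply inv_left; auto].
Qed.

Lemma gen_line_homeo X : (forall f, X f -> homeo f) -> forall f, gen X f -> line_homeo f.
Proof.
  intros HX f hf. induction hf.
  - apply line_homeo_id.
  - apply homeo_line_homeo; auto.
  - apply line_homeo_inv; auto.
  - apply line_homeo_mul; auto.
Qed.

(** The point c is the supremum of the fixed points at or before t, a set that contains 0. It is
    itself fixed because fixed points form a closed set. *)
Lemma last_fixed_point g t :
  line_homeo g -> g t <> t ->
  exists c, c < t /\ g c = c /\ forall s, c < s <= t -> g s <> s.
Proof.
  intros hg ht. pose proof (line_homeo_continuity g hg) as hc.
  destruct hg as [h1 [h2 h3]].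
  assert (0 < t < 1) by (apply NNPP; intro; apply ht; auto).
  destruct (completeness (fun s => s <= t /\ g s = s)) as [c [hub hlub]].
  - exists t. intros s [hs _]; auto.
  - exists 0. split; [lra|]. apply h3; lra.
  - assert (hct : c <= t) by (apply hlub; intros s [hs _]; auto).
    assert (hg : g c = c).
    { apply NNPP; intro ne.
      assert (hcc : continuity (fun s => g s - s)).
      { apply continuity_minus; auto. apply derivable_continuous, derivable_id. }
      apply continuityE with (x := c) (eps := Rabs (g c - c)) in hcc.
      2:{ apply Rabs_pos_lt; lra. }
      destruct hcc as [d [hd Hd]].
      (* If c moved, a whole d-neighbourhood of c would move, and c - d would be a smaller upper
         bound. *)
      assert (c <= c - d); [|lra]. apply hlub. intros s [hs1 hs2].
      assert (hsc : s <= c) by (apply hub; split; auto).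
      destruct (Rle_lt_dec s (c - d)); auto. exfalso.
      assert (hh : Rabs (s - c) < d) by (apply Rabs_def1; lra).
      apply Hd in hh. rewrite hs2 in hh.
      replace (s - s - (g c - c)) with (- (g c - c)) in hh by ring.
      rewrite Rabs_Ropp in hh. lra. }
    exists c. split; [|split]; auto.
    + destruct hct; auto. subst; contradiction.
    + intros s hs e. assert (s <= c) by (apply hub; split; [lra|auto]). lra.
Qed.

(** * Realizations of a labelled matching *)

(* Vertices are 0, ..., size - 1; [partner v] is the other end of the edge at [v], and [rising v]
   says that this edge points from the smaller to the larger vertex. *)
Record matching := Matching {
  size : nat;
  partner : nat -> nat;
  label : nat -> nat;
  rising : nat -> bool;
}.

Record is_matching (M : matching) : Prop := {
  partner_lt : forall v, (v < size M)%nat -> (partner M v < size M)%nat;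
  partnerK : forall v, (v < size M)%nat -> partner M (partner M v) = v;
  partner_neq : forall v, (v < size M)%nat -> partner M v <> v;
  label_partner : forall v, (v < size M)%nat -> label M (partner M v) = label M v;
  rising_partner : forall v, (v < size M)%nat -> rising M (partner M v) = rising M v;
}.

(** One representative per edge: in a realization the opening vertex carries the left foot of the
    orbital, and its partner the right foot. *)
Definition opening (M : matching) (v : nat) : Prop := (v < size M)%nat /\ (v < partner M v)%nat.

Lemma opening_cases M v : is_matching M -> (v < size M)%nat -> opening M v \/ opening M (partner M v).
Proof.
  intros hM hv. unfold opening.
  pose proof (partner_neq M hM v hv). pose proof (partner_lt M hM v hv).
  rewrite (partnerK M hM v hv). lia.
Qed.

Lemma opening_partner_lt M v : is_matching M -> opening M v -> (partner M v < size M)%nat.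
Proof. intros hM [h _]. apply partner_lt; auto. Qed.

(* The foot of [v] is [l v, r v). If [v] is opening then [E v] is the positive bump with feet [v] and
   [partner v]; [E (partner v)] is its inverse. So [E v] is the map expanding the foot of [v].
   [F] lists the generators by label. *)
Record realizes (M : matching) (l r : nat -> R) (E F : nat -> R -> R) : Prop := {
  foot_lt : forall v, (v < size M)%nat -> l v < r v;
  foot_sep : forall v w, (v < w)%nat -> (w < size M)%nat -> r v <= l w;
  foot_lb : forall v, (v < size M)%nat -> 0 <= l v;
  foot_ub : forall v, (v < size M)%nat -> r v <= 1;
  E_homeo : forall v, (v < size M)%nat -> line_homeo (E v);
  E_partner : forall v t, (v < size M)%nat -> E (partner M v) (E v t) = t;
  E_mid : forall v, opening M v -> E v (r v) = l (partner M v);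
  E_off : forall v t, opening M v -> ~ (l v < t < r (partner M v)) -> E v t = t;
  E_pos : forall v t, opening M v -> l v < t < r (partner M v) -> t < E v t;
  F_homeo : forall v, (v < size M)%nat -> line_homeo (F (label M v));
  F_on : forall v t, opening M v -> l v <= t <= r (partner M v) ->
    F (label M v) t = (if rising M v then E v t else E (partner M v) t);
  F_off : forall lam t,
    (forall v, opening M v -> label M v = lam -> ~ (l v < t < r (partner M v))) -> F lam t = t;
}.

(** [F] is defined at every natural number; indexing by vertices keeps only the labels that occur in
    the matching. *)
Definition generators (M : matching) (F : nat -> R -> R) (f : R -> R) : Prop :=
  exists v, (v < size M)%nat /\ f = F (label M v).

Section Realization.

Context (M : matching) (hM : is_matching M) (l r : nat -> R) (E F : nat -> R -> R)
  (hR : realizes M l r E F).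

Lemma l_lt v w : (v < w)%nat -> (w < size M)%nat -> l v < l w.
Proof.
  intros h1 h2. pose proof (foot_lt _ _ _ _ _ hR v ltac:(lia)).
  pose proof (foot_sep _ _ _ _ _ hR v w h1 h2). lra.
Qed.

Lemma r_lt v w : (v < w)%nat -> (w < size M)%nat -> r v < r w.
Proof.
  intros h1 h2. pose proof (foot_lt _ _ _ _ _ hR w h2).
  pose proof (foot_sep _ _ _ _ _ hR v w h1 h2). lra.
Qed.

Lemma l_inj v w : (v < size M)%nat -> (w < size M)%nat -> l v = l w -> v = w.
Proof.
  intros h1 h2 e. destruct (lt_eq_lt_dec v w) as [[h|h]|h]; auto;
  apply l_lt in h; auto; lra.
Qed.

Lemma r_inj v w : (v < size M)%nat -> (w < size M)%nat -> r v = r w -> v = w.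
Proof.
  intros h1 h2 e. destruct (lt_eq_lt_dec v w) as [[h|h]|h]; auto;
  apply r_lt in h; auto; lra.
Qed.

Lemma foot_disjoint v w t : (v < size M)%nat -> (w < size M)%nat ->
  l v <= t < r v -> l w <= t < r w -> v = w.
Proof.
  intros h1 h2 a b. destruct (lt_eq_lt_dec v w) as [[h|h]|h]; auto;
  apply (foot_sep _ _ _ _ _ hR) in h; auto; lra.
Qed.

Lemma partner_E v t : (v < size M)%nat -> E v (E (partner M v) t) = t.
Proof.
  intros hv. pose proof (E_partner _ _ _ _ _ hR (partner M v) t (partner_lt M hM v hv)) as h.
  rewrite (partnerK M hM v hv) in h. exact h.
Qed.

Lemma E_increasing v : (v < size M)%nat -> strict_increasing (E v).
Proof. intros hv. exact (proj1 (E_homeo _ _ _ _ _ hR v hv)). Qed.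

(** The strict last inequality holds because [E v] moves [r v] to [l (partner M v)], hence strictly
    to the right. It forces the model to leave room between two adjacent feet of one bump. *)
Lemma opening_order v : opening M v ->
  l v < r v /\ r v <= l (partner M v) /\ l (partner M v) < r (partner M v) /\ r v < l (partner M v).
Proof.
  intros hv. pose proof (opening_partner_lt M v hM hv) as hp. pose proof hv as [h1 h2].
  pose proof (foot_lt _ _ _ _ _ hR v h1). pose proof (foot_lt _ _ _ _ _ hR _ hp).
  pose proof (foot_sep _ _ _ _ _ hR v _ h2 hp).
  pose proof (E_pos _ _ _ _ _ hR v (r v) hv ltac:(lra)).
  rewrite (E_mid _ _ _ _ _ hR v hv) in *. auto.
Qed.

Lemma E_l v : opening M v -> E v (l v) = l v.
Proof. intros hv. apply (E_off _ _ _ _ _ hR); auto; lra. Qed.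

Lemma E_r v : opening M v -> E v (r (partner M v)) = r (partner M v).
Proof. intros hv. apply (E_off _ _ _ _ _ hR); auto; lra. Qed.

Lemma E_partner_l v : opening M v -> E (partner M v) (l (partner M v)) = r v.
Proof.
  intros hv. rewrite <- (E_mid _ _ _ _ _ hR v hv). apply (E_partner _ _ _ _ _ hR). exact (proj1 hv).
Qed.

Lemma E_partner_off v t : opening M v -> ~ (l v < t < r (partner M v)) -> E (partner M v) t = t.
Proof.
  intros hv ht. rewrite <- (E_off _ _ _ _ _ hR v t hv ht) at 1.
  apply (E_partner _ _ _ _ _ hR). exact (proj1 hv).
Qed.

Lemma E_orbital v t : opening M v -> l v < t < r (partner M v) -> l v < E v t < r (partner M v).
Proof.
  intros hv [a b]. apply (E_increasing v) in a, b; try exact (proj1 hv).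
  rewrite E_l in a; auto. rewrite E_r in b; auto.
Qed.

Lemma E_partner_orbital v t : opening M v ->
  l v < t < r (partner M v) -> l v < E (partner M v) t < r (partner M v).
Proof.
  intros hv [a b]. pose proof (opening_partner_lt M v hM hv) as hp.
  apply (E_increasing _ hp) in a, b.
  rewrite E_partner_off in a; auto; try lra. rewrite (E_partner_off v (r _)) in b; auto; lra.
Qed.

Lemma E_neg v t : opening M v -> l v < t < r (partner M v) -> E (partner M v) t < t.
Proof.
  intros hv ht. pose proof (E_pos _ _ _ _ _ hR v _ hv (E_partner_orbital v t hv ht)) as h.
  rewrite partner_E in h; auto. exact (proj1 hv).
Qed.

Lemma F_moves v t : opening M v -> l v < t < r (partner M v) -> F (label M v) t <> t.
Proof.
  intros hv ht. rewrite (F_on _ _ _ _ _ hR v t hv) by lra.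
  pose proof (E_pos _ _ _ _ _ hR v t hv ht). pose proof (E_neg v t hv ht).
  destruct (rising M v); lra.
Qed.

Lemma F_l v : opening M v -> F (label M v) (l v) = l v.
Proof.
  intros hv. pose proof (opening_order v hv).
  rewrite (F_on _ _ _ _ _ hR v _ hv) by lra.
  rewrite E_l by auto. rewrite E_partner_off by (auto; lra). destruct (rising M v); auto.
Qed.

Lemma F_r v : opening M v -> F (label M v) (r (partner M v)) = r (partner M v).
Proof.
  intros hv. pose proof (opening_order v hv).
  rewrite (F_on _ _ _ _ _ hR v _ hv) by lra.
  rewrite E_r by auto. rewrite (E_partner_off v (r _)) by (auto; lra). destruct (rising M v); auto.
Qed.

Lemma F_supt lam t : F lam t <> t ->
  exists v, opening M v /\ label M v = lam /\ l v < t < r (partner M v).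
Proof.
  intros h. apply NNPP. intro H. apply h. apply (F_off _ _ _ _ _ hR).
  intros v hv hl ht. apply H. eauto.
Qed.

(** If the orbital at w began inside the orbital at v, its left end would be both fixed and moved by
    their common generator. This necessary condition on a diagram separates the realizable ones from
    the others. *)
Lemma same_label_disjoint v w : opening M v -> opening M w -> label M v = label M w ->
  (v < w)%nat -> (partner M v < w)%nat.
Proof.
  intros hv hw e h. apply NNPP. intro H.
  assert (hpw : partner M v <> w).
  { intro e'. destruct hw as [_ hw]. rewrite <- e' in hw.
    rewrite (partnerK M hM v) in hw by exact (proj1 hv). destruct hv. lia. }
  pose proof (opening_partner_lt M v hM hv) as hp.
  assert (a : l v < l w) by (apply l_lt; auto; exact (proj1 hw)).
  assert (b : l w < l (partner M v)) by (apply l_lt; auto; lia).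
  pose proof (opening_order v hv).
  apply (F_moves v (l w) hv); [lra|]. rewrite e. apply F_l; auto.
Qed.

Lemma right_separation (p : nat -> R) t k :
  exists eps, eps > 0 /\ forall v, (v < k)%nat -> t < p v -> t + eps <= p v.
Proof.
  induction k as [|k [eps [he IH]]].
  - exists 1; split; [lra|]. intros; lia.
  - destruct (Rlt_le_dec t (p k)) as [h|h].
    + exists (Rmin eps (p k - t)). pose proof (Rmin_l eps (p k - t)). pose proof (Rmin_r eps (p k - t)).
      split; [apply Rmin_pos; lra|]. intros v hv ht.
      destruct (Nat.eq_dec v k) as [->|]; [lra|]. specialize (IH v ltac:(lia) ht). lra.
    + exists eps; split; auto. intros v hv ht.
      destruct (Nat.eq_dec v k) as [->|]; [lra|]. apply IH; auto; lia.
Qed.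

Lemma left_separation (p : nat -> R) t k :
  exists eps, eps > 0 /\ forall v, (v < k)%nat -> p v < t -> p v <= t - eps.
Proof.
  destruct (right_separation (fun v => - p v) (- t) k) as [eps [he H]].
  exists eps; split; auto. intros v hv h. specialize (H v hv ltac:(lra)). simpl in H. lra.
Qed.

(** Finitely many orbitals begin to the right of t, so moved points close enough to t lie in an
    orbital that begins at t or earlier. If it began earlier, t would be moved too. *)
Lemma F_left_tp lam t : left_tp (F lam) t -> exists v, opening M v /\ label M v = lam /\ t = l v.
Proof.
  intros [h1 h2]. destruct (right_separation l t (size M)) as [eps [he H]].
  destruct (h2 eps he) as [s [hs hs']].
  destruct (F_supt _ _ hs') as [v [hv [hl hvs]]]. exists v; split; auto. split; auto.
  destruct (Rtotal_order t (l v)) as [h|[h|h]]; auto.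
  - apply H in h; [lra|exact (proj1 hv)].
  - exfalso. apply h1. unfold supt. rewrite <- hl. apply F_moves; auto. lra.
Qed.

Lemma F_right_tp lam t : right_tp (F lam) t ->
  exists v, opening M v /\ label M v = lam /\ t = r (partner M v).
Proof.
  intros [h1 h2]. destruct (left_separation r t (size M)) as [eps [he H]].
  destruct (h2 eps he) as [s [hs hs']].
  destruct (F_supt _ _ hs') as [v [hv [hl hvs]]]. exists v; split; auto. split; auto.
  destruct (Rtotal_order t (r (partner M v))) as [h|[h|h]]; auto.
  - exfalso. apply h1. unfold supt. rewrite <- hl. apply F_moves; auto. lra.
  - apply H in h; [lra|]. apply opening_partner_lt; auto.
Qed.

Lemma left_tp_l v : opening M v -> left_tp (F (label M v)) (l v).
Proof.
  intros hv. pose proof (opening_order v hv) as ho. split.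
  - unfold supt. intro h. apply h. apply F_l; auto.
  - intros eps he. exists (l v + Rmin eps (r v - l v) / 2).
    pose proof (Rmin_l eps (r v - l v)). pose proof (Rmin_r eps (r v - l v)).
    assert (0 < Rmin eps (r v - l v)) by (apply Rmin_pos; lra).
    split; [lra|]. apply F_moves; auto; lra.
Qed.

(** * Least transition points and geometric fastness of a realization *)

(** These vertices correspond one to one to labels, and their left ends are the least transition
    points. The order of the generators is thus visible in the matching alone. *)
Definition first_with_label (v : nat) : Prop :=
  forall w, (w < v)%nat -> label M w <> label M v.

Lemma first_with_label_opening v : (v < size M)%nat -> first_with_label v -> opening M v.
Proof.
  intros hv hf. split; auto. apply Nat.nle_gt. intro h.
  pose proof (partner_neq M hM v hv).
  apply (hf (partner M v)); [lia|]. apply label_partner; auto.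
Qed.

Lemma least_tp_first v : (v < size M)%nat -> first_with_label v -> least_tp (F (label M v)) (l v).
Proof.
  intros hv hf. pose proof (first_with_label_opening v hv hf) as ho. split.
  - left. apply left_tp_l; auto.
  - intros s hs.
    assert (exists w, opening M w /\ label M w = label M v /\ l w <= s) as [w [hw [e hws]]].
    { destruct hs as [hs|hs].
      - destruct (F_left_tp _ _ hs) as [w [hw [e ->]]]. exists w. split; [auto|split; [auto|lra]].
      - destruct (F_right_tp _ _ hs) as [w [hw [e ->]]]. exists w. split; [auto|split; [auto|]].
        pose proof (opening_order w hw). lra. }
    destruct (lt_eq_lt_dec v w) as [[h|h]|h].
    + apply l_lt in h; [lra|exact (proj1 hw)].
    + subst; auto.
    + exfalso. apply (hf w h e).
Qed.

Lemma generators_homeo f : generators M F f -> homeo f.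
Proof. intros [v [hv ->]]. apply line_homeo_homeo. apply (F_homeo _ _ _ _ _ hR v hv). Qed.

Lemma geom_proper_generators : geom_proper (generators M F).
Proof.
  split; intros f g t [v [hv ->]] [w [hw ->]] hf hg.
  - destruct (F_left_tp _ _ hf) as [v' [hv' [<- e1]]].
    destruct (F_left_tp _ _ hg) as [w' [hw' [<- e2]]].
    replace w' with v'; auto. apply l_inj; try exact (proj1 hv'); try exact (proj1 hw'). congruence.
  - destruct (F_right_tp _ _ hf) as [v' [hv' [<- e1]]].
    destruct (F_right_tp _ _ hg) as [w' [hw' [<- e2]]].
    replace w' with v'; auto.
    rewrite <- (partnerK M hM v'), <- (partnerK M hM w') by (apply hv' || exact (proj1 hw')).
    f_equal. apply r_inj; try (apply opening_partner_lt; auto). congruence.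
Qed.

(** The generator moves every point of the orbital of a and fixes both of its ends, so this orbital
    is that of some opening v. Positivity of a then selects [E v] rather than its inverse. *)
Lemma used_generators a : used (generators M F) a -> exists v, opening M v /\ a = E v.
Proof.
  intros [[[ha [x [y [hxy hs]]]] hp] [f [[v0 [hv0 ->]] hf]]].
  set (lam := label M v0) in *.
  pose proof (homeo_line_homeo a ha) as hla.
  pose proof (line_homeo_inv a hla) as hia.
  pose proof (F_homeo _ _ _ _ _ hR v0 hv0) as hF. fold lam in hF.
  assert (hfix : forall t, ~ (x < t < y) -> a t = t).
  { intros t ht. apply NNPP. intro h. apply ht. apply hs. exact h. }
  assert (hmov : forall t, x < t < y -> F lam t <> t).
  { intros t ht e. apply hs in ht. destruct hf as [hf|hf].
    - apply ht. rewrite <- (hf t ht). auto.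
    - apply ht. rewrite (hf t ht) in e. rewrite <- e at 1. apply inv_right. exact (proj1 (proj2 hla)). }
  assert (hend : forall t, t = x \/ t = y -> F lam t = t).
  { intros t ht. destruct hf as [hf|hf].
    - rewrite (continuity_agree_closure (F lam) a x y); auto using line_homeo_continuity.
      + apply hfix; lra.
      + intros s hs'. apply hf, hs; auto.
      + lra.
    - rewrite (continuity_agree_closure (F lam) (inv a) x y); auto using line_homeo_continuity.
      + apply inv_eq; auto. apply hfix; lra.
      + intros s hs'. apply hf, hs; auto.
      + lra. }
  destruct (F_supt lam ((x + y) / 2)) as [v [hv [e ht]]]; [apply hmov; lra|].
  assert (hx : x = l v).
  { destruct (Rtotal_order x (l v)) as [h|[h|h]]; auto; exfalso.
    - apply (hmov (l v)); [lra|]. rewrite <- e. apply F_l; auto.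
    - apply (F_moves v x hv); [lra|]. rewrite e. apply hend; auto. }
  assert (hy : y = r (partner M v)).
  { destruct (Rtotal_order y (r (partner M v))) as [h|[h|h]]; auto; exfalso.
    - apply (F_moves v y hv); [lra|]. rewrite e. apply hend; auto.
    - apply (hmov (r (partner M v))); [lra|]. rewrite <- e. apply F_r; auto. }
  exists v; split; auto. apply functional_extensionality. intros t.
  destruct (classic (x < t < y)) as [h|h].
  2:{ rewrite hfix, (E_off _ _ _ _ _ hR); auto. rewrite <- hx, <- hy; auto. }
  pose proof (proj2 (hs _) h) as h'. pose proof (hp t h') as hpos.
  assert (hE : forall s, x < s < y -> F lam s = (if rising M v then E v s else E (partner M v) s)).
  { intros s hs'. rewrite <- e. apply (F_on _ _ _ _ _ hR); auto. lra. }
  assert (hvt : x < E v t < y) by (subst x y; apply E_orbital; auto).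
  destruct hf as [hf|hf].
  - rewrite <- (hf t h'), hE by auto. destruct (rising M v) eqn:er; auto. exfalso.
    rewrite <- (hf t h'), hE in hpos by auto.
    pose proof (E_neg v t hv ltac:(lra)). lra.
  (* Here the generator agrees with the inverse of a. Evaluating at [E v t] instead of t either
     contradicts the direction of motion or, after cancelling, gives [a t = E v t]. *)
  - pose proof (hf _ (proj2 (hs _) hvt)) as h2. rewrite hE in h2 by auto.
    destruct (rising M v) eqn:er.
    + exfalso. assert (hlt : inv a (E v t) < E v t).
      { apply (strict_increasing_lt_inv a); [exact (proj1 hla)|]. rewrite inv_right by exact (proj1 (proj2 hla)).
        apply hp. apply hs; auto. }
      rewrite <- h2 in hlt. pose proof (E_pos _ _ _ _ _ hR v (E v t) hv ltac:(lra)). lra.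
    + rewrite (E_partner _ _ _ _ _ hR v t) in h2 by exact (proj1 hv).
      rewrite h2 at 1. apply inv_right. exact (proj1 (proj2 hla)).
Qed.

Lemma E_supt v t : opening M v -> (supt (E v) t <-> l v < t < r (partner M v)).
Proof.
  intros hv. split.
  - intros h. apply NNPP. intro h'. apply h. apply (E_off _ _ _ _ _ hR); auto.
  - intros h. pose proof (E_pos _ _ _ _ _ hR v t hv h). unfold supt. lra.
Qed.

Lemma E_left_tp v t : opening M v -> left_tp (E v) t -> t = l v.
Proof.
  intros hv [h1 h2]. rewrite E_supt in h1 by auto. pose proof (opening_order v hv).
  destruct (Rtotal_order t (l v)) as [h|[h|h]]; auto; exfalso.
  - destruct (h2 (l v - t) ltac:(lra)) as [s [hs hs']]. apply E_supt in hs'; auto. lra.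
  - destruct (h2 1 ltac:(lra)) as [s [hs hs']]. apply E_supt in hs'; auto. lra.
Qed.

Lemma E_right_tp v t : opening M v -> right_tp (E v) t -> t = r (partner M v).
Proof.
  intros hv [h1 h2]. rewrite E_supt in h1 by auto. pose proof (opening_order v hv).
  destruct (Rtotal_order t (r (partner M v))) as [h|[h|h]]; auto; exfalso.
  - destruct (h2 1 ltac:(lra)) as [s [hs hs']]. apply E_supt in hs'; auto. lra.
  - destruct (h2 (t - r (partner M v)) ltac:(lra)) as [s [hs hs']]. apply E_supt in hs'; auto. lra.
Qed.

Lemma E_inj v w : opening M v -> opening M w -> E v = E w -> v = w.
Proof.
  intros hv hw e. apply l_inj; try exact (proj1 hv); try exact (proj1 hw).
  apply (E_left_tp w); auto. rewrite <- e. split.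
  - rewrite E_supt by auto. lra.
  - intros eps he. pose proof (opening_order v hv). exists (l v + Rmin eps (r v - l v) / 2).
    pose proof (Rmin_l eps (r v - l v)). pose proof (Rmin_r eps (r v - l v)).
    assert (0 < Rmin eps (r v - l v)) by (apply Rmin_pos; lra).
    split; [lra|]. apply E_supt; auto; lra.
Qed.

(** With marker [r v] for [E v], the destination foot starts at [l (partner M v)]. The feet of the
    marking lie in the half open feet of the realization, which are disjoint. *)
Lemma geom_fast_generators : geom_fast (generators M F).
Proof.
  split; [apply geom_proper_generators|]. split; [intros a [h _]; exact h|]. split.
  - split; intros a b t ha hb h1 h2;
    destruct (used_generators a ha) as [v [hv ->]]; destruct (used_generators b hb) as [w [hw ->]];
    f_equal.
    + apply l_inj; try exact (proj1 hv); try exact (proj1 hw).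
      rewrite <- (E_left_tp v t), <- (E_left_tp w t); auto.
    + rewrite <- (partnerK M hM v), <- (partnerK M hM w) by (apply hv || exact (proj1 hw)).
      f_equal. apply r_inj; try (apply opening_partner_lt; auto).
      rewrite <- (E_right_tp v t), <- (E_right_tp w t); auto.
  (* The marker must be a function of the bump; v is recovered from [E v] by choice, which is
     unambiguous by [E_inj]. *)
  - set (m := fun a : R -> R =>
      epsilon (inhabits 0) (fun t => exists v, opening M v /\ a = E v /\ t = r v)).
    assert (hm : forall v, opening M v -> m (E v) = r v).
    { intros v hv. unfold m.
      match goal with |- epsilon ?i ?P = _ => destruct (epsilon_spec i P) as [w [hw [e ->]]] end.
      - exists (r v), v. auto.
      - apply (E_inj v w hv hw) in e. congruence. }
    exists m. split.
    + intros a ha. destruct (used_generators a ha) as [v [hv ->]].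
      rewrite hm by auto. apply E_supt; auto. pose proof (opening_order v hv). lra.
    + intros a b s s' ha hb hne t [h1 h2].
      destruct (used_generators a ha) as [v [hv ->]]. destruct (used_generators b hb) as [w [hw ->]].
      assert (hft : forall v s, opening M v -> foot m (E v) s t ->
         let u := if s then partner M v else v in l u <= t < r u).
      { clear - hm hM hR. intros v s hv. unfold foot. rewrite hm by auto.
        rewrite (E_mid _ _ _ _ _ hR v hv).
        destruct s; simpl; rewrite E_supt by auto; lra. }
      pose proof (hft v s hv h1) as a1. pose proof (hft w s' hw h2) as a2. simpl in a1, a2.
      pose proof (opening_partner_lt M v hM hv). pose proof (opening_partner_lt M w hM hw).
      assert (e : (if s then partner M v else v) = (if s' then partner M w else w)).
      { apply (foot_disjoint _ _ t); auto.
        - destruct s; [auto|exact (proj1 hv)].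
        - destruct s'; [auto|exact (proj1 hw)]. }
      destruct hv as [hv1 hv2], hw as [hw1 hw2].
      pose proof (partnerK M hM v hv1). pose proof (partnerK M hM w hw1).
      destruct s, s'.
      * apply hne. f_equal. f_equal. congruence.
      * subst w. lia.
      * subst v. lia.
      * apply hne. congruence.
Qed.

End Realization.

(** * Addresses and faithfulness *)

Section Addresses.

Context (M : matching) (hM : is_matching M) (l r : nat -> R) (E F : nat -> R -> R)
  (hR : realizes M l r E F).

Fixpoint follow (p : list nat) (t : R) : R :=
  match p with nil => t | v :: p => follow p (E v t) end.

Fixpoint has_address (p : list nat) (t : R) : Prop :=
  match p with
  | nil => True
  | v :: p => (v < size M)%nat /\ l v <= t < r v /\ has_address p (E v t)
  end.

(* The classes are the feet and the gaps between them. *)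
Definition same_atom (s t : R) : Prop :=
  forall v, (v < size M)%nat -> (l v <= s <-> l v <= t) /\ (r v <= s <-> r v <= t).

Lemma same_atom_refl t : same_atom t t.
Proof. intros v _. tauto. Qed.

Lemma same_atom_sym s t : same_atom s t -> same_atom t s.
Proof. intros h v hv. specialize (h v hv). tauto. Qed.

Lemma same_atom_foot v s t : (v < size M)%nat -> l v <= s < r v -> l v <= t < r v -> same_atom s t.
Proof.
  intros hv hs ht w hw. pose proof (foot_lt _ _ _ _ _ hR w hw).
  destruct (lt_eq_lt_dec w v) as [[h|h]|h].
  - pose proof (foot_sep _ _ _ _ _ hR w v h hv). lra.
  - subst. lra.
  - pose proof (foot_sep _ _ _ _ _ hR v w h hw). lra.
Qed.

(* The image of a foot under its expanding map is a union of atoms. *)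
Lemma foot_preimage v s t : (v < size M)%nat -> l v <= t < r v -> same_atom (E v t) s ->
  l v <= E (partner M v) s < r v.
Proof.
  intros hv ht h. pose proof (partner_lt M hM v hv) as hp.
  pose proof (strict_increasing_le _ (E_increasing M l r E F hR v hv)) as hi.
  pose proof (E_increasing M l r E F hR v hv) as hi'.
  destruct (h v hv) as [a1 a2]. destruct (h _ hp) as [b1 b2].
  assert (a : l v <= t) by lra. assert (b : t < r v) by lra.
  apply hi in a. apply hi' in b.
  (* The ends of the image of the foot are again ends of feet: the image is [l v, l (partner v)) if
     v is opening and [r (partner v), r v) otherwise. *)
  assert (H : E v (l v) <= s < E v (r v)).
  { destruct (opening_cases M v hM hv) as [ho|ho].
    - rewrite (E_l M l r E F hR v ho) in *.
      rewrite (E_mid _ _ _ _ _ hR v ho) in *.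
      split; [tauto|]. apply Rnot_le_lt. intro c. apply b1 in c. lra.
    - pose proof (E_partner_l M l r E F hR _ ho) as e1.
      pose proof (E_partner_off M l r E F hR _ (r v) ho) as e2.
      rewrite (partnerK M hM v hv) in *. rewrite e1 in *. rewrite e2 in * by lra.
      split; [tauto|]. apply Rnot_le_lt. intro c. apply a2 in c. lra. }
  rewrite <- (partner_E M hM l r E F hR v s hv) in H.
  split.
  - apply (strict_increasing_le_inv _ hi'). lra.
  - apply (strict_increasing_lt_inv _ hi'). lra.
Qed.

(** This is the Markov property. Pulling z back one letter at a time stays inside the successive
    feet, hence in the atom required by the next step. *)
Lemma follow_onto_atom p t z : has_address p t -> same_atom (follow p t) z ->
  exists s, has_address p s /\ follow p s = z /\ same_atom t s.
Proof.
  revert t. induction p as [|v p IH]; simpl; intros t hp hz.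
  - exists z. auto.
  - destruct hp as [hv [ht hp]]. destruct (IH _ hp hz) as [s [h1 [h2 h3]]].
    pose proof (foot_preimage v s t hv ht h3).
    exists (E (partner M v) s). rewrite (partner_E M hM l r E F hR v s hv).
    split; [auto|]. split; auto. apply (same_atom_foot v); auto.
Qed.

Lemma follow_inj p s t : has_address p s -> has_address p t -> follow p s = follow p t -> s = t.
Proof.
  revert s t. induction p as [|v p IH]; simpl; auto.
  intros s t [hv [hs hps]] [_ [ht hpt]] e.
  apply (strict_increasing_inj _ (E_increasing M l r E F hR v hv)). auto.
Qed.

Lemma follow_app p q t : follow (p ++ q) t = follow q (follow p t).
Proof. revert t. induction p; simpl; auto. Qed.

Lemma has_address_app p q t : has_address (p ++ q) t <-> has_address p t /\ has_address q (follow p t).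
Proof. revert t. induction p as [|v p IH]; simpl; intros t; [tauto|]. rewrite IH. tauto. Qed.

(** Feet are disjoint, so each letter of an address is forced and two addresses of one point differ
    only in length. *)
Lemma address_comparable p q t : has_address p t -> has_address q t ->
  (exists e, q = p ++ e) \/ (exists e, p = q ++ e).
Proof.
  revert q t. induction p as [|v p IH]; intros q t hp hq.
  - left. exists q. auto.
  - destruct q as [|w q].
    + right. exists (v :: p). auto.
    + simpl in hp, hq. destruct hp as [hv [ht hp]]. destruct hq as [hw [ht' hq]].
      assert (v = w) by (apply (foot_disjoint M l r E F hR v w t); auto). subst w.
      destruct (IH _ _ hp hq) as [[e ->]|[e ->]]; [left|right]; exists e; auto.
Qed.

(** Feet and gaps are half open on the right and the expanding maps are increasing and continuous.
    The analogous statement on the left fails at left ends of feet. *)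
Lemma address_right_nbhd p t : has_address p t ->
  exists eps, eps > 0 /\ forall s, t <= s < t + eps ->
    has_address p s /\ same_atom (follow p t) (follow p s).
Proof.
  revert t. induction p as [|v p IH]; simpl; intros t ht.
  - destruct (right_separation l t (size M)) as [e1 [h1 H1]].
    destruct (right_separation r t (size M)) as [e2 [h2 H2]].
    exists (Rmin e1 e2). pose proof (Rmin_l e1 e2). pose proof (Rmin_r e1 e2).
    split; [apply Rmin_pos; auto|]. intros s hs. split; auto. intros v hv.
    specialize (H1 v hv). specialize (H2 v hv).
    lra.
  - destruct ht as [hv [ht hp]]. destruct (IH _ hp) as [e [he H]].
    pose proof (line_homeo_continuity _ (E_homeo _ _ _ _ _ hR v hv)) as hc.
    rewrite continuityE in hc. destruct (hc t e he) as [d [hd Hd]].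
    exists (Rmin d (r v - t)). pose proof (Rmin_l d (r v - t)). pose proof (Rmin_r d (r v - t)).
    split; [apply Rmin_pos; lra|]. intros s hs.
    assert (hs' : Rabs (s - t) < d) by (apply Rabs_def1; lra).
    apply Hd in hs'. apply Rabs_def2 in hs'.
    assert (E v t <= E v s).
    { apply (strict_increasing_le _ (E_increasing M l r E F hR v hv)). lra. }
    destruct (H (E v s) ltac:(lra)). split; auto. split; auto. split; auto. lra.
Qed.

(* Near each point, [g] removes the address prefix [p] and then adds the prefix [q]. This is the
   ping-pong argument; stating it on a whole cylinder is what lets [theta] see [g]. *)
Definition prefix_replacing (g : R -> R) : Prop :=
  forall t, exists p q, has_address p t /\
    forall s, has_address p s -> same_atom (follow p t) (follow p s) ->
      has_address q (g s) /\ follow q (g s) = follow p s.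

Lemma prefix_replacing_id : prefix_replacing idf.
Proof. intros t. exists nil, nil. simpl. unfold idf. auto. Qed.

(** Closed on the left, open on the right, an orbital is a union of atoms, so one formula for the
    generator is valid on the whole atom of t. *)
Lemma orbital_atom v s t : opening M v -> same_atom t s ->
  l v <= t < r (partner M v) -> l v <= s < r (partner M v).
Proof.
  intros hv h [a b]. pose proof (opening_partner_lt M v hM hv) as hp.
  destruct (h v (proj1 hv)) as [h1 _]. destruct (h _ hp) as [_ h2].
  split; [apply h1; auto|]. apply Rnot_le_lt. intro c. apply h2 in c. lra.
Qed.

(** On one foot of an orbital the generator is the expanding map and deletes a letter. On the rest
    of the orbital its value lies in the other foot, whose expanding map undoes it, so a letter is
    added. Off its orbitals nothing changes. *)
Lemma prefix_replacing_F v0 : (v0 < size M)%nat -> prefix_replacing (F (label M v0)).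
Proof.
  intros hv0 t. set (lam := label M v0).
  destruct (classic (exists v, opening M v /\ label M v = lam /\ l v <= t < r (partner M v)))
    as [[v [hv [e ht]]]|no].
  - pose proof (opening_partner_lt M v hM hv) as hp. pose proof hv as [hv1 hv2].
    pose proof (opening_order M hM l r E F hR v hv) as ho.
    assert (hF : forall s, l v <= s < r (partner M v) ->
      F lam s = if rising M v then E v s else E (partner M v) s).
    { intros s hs. rewrite <- e. apply (F_on _ _ _ _ _ hR); auto. lra. }
    pose proof (E_increasing M l r E F hR v hv1) as iv.
    pose proof (E_increasing M l r E F hR _ hp) as ip.
    destruct (rising M v).
    + destruct (Rlt_le_dec t (r v)) as [h|h].
      * exists (v :: nil), nil. simpl. split; [repeat split; auto; lra|].
        intros s [_ [hs _]] _. split; auto. apply hF. lra.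
      * exists nil, (partner M v :: nil). simpl. split; auto. intros s _ hs.
        pose proof (orbital_atom v s t hv hs ht) as hs'.
        destruct (hs v hv1) as [_ [hs2 _]]. specialize (hs2 h).
        rewrite hF by auto. rewrite (E_partner _ _ _ _ _ hR) by auto.
        split; auto. split; auto. split; auto.
        apply (strict_increasing_le _ iv) in hs2. rewrite (E_mid _ _ _ _ _ hR v hv) in hs2.
        split; auto. rewrite <- (E_r M l r E F hR v hv). apply iv. lra.
    + destruct (Rle_lt_dec (l (partner M v)) t) as [h|h].
      * exists (partner M v :: nil), nil. simpl. split; [repeat split; auto; lra|].
        intros s [_ [hs _]] _. split; auto. apply hF. lra.
      * exists nil, (v :: nil). simpl. split; auto. intros s _ hs.
        pose proof (orbital_atom v s t hv hs ht) as hs'.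
        assert (hs2 : s < l (partner M v)).
        { apply Rnot_le_lt. intro c. apply (hs _ hp) in c. lra. }
        rewrite hF by auto. rewrite (partner_E M hM l r E F hR) by auto.
        split; auto. split; auto. split; auto. split.
        -- apply (strict_increasing_le_inv _ iv). rewrite (partner_E M hM l r E F hR) by auto.
           rewrite (E_l M l r E F hR v hv). lra.
        -- apply (strict_increasing_lt_inv _ iv). rewrite (partner_E M hM l r E F hR) by auto.
           rewrite (E_mid _ _ _ _ _ hR v hv). auto.
  - exists nil, nil. simpl. split; auto. intros s _ hs. split; auto.
    apply (F_off _ _ _ _ _ hR). intros v hv e hsv. apply no. exists v. split; auto. split; auto.
    apply (orbital_atom v t s hv); [apply same_atom_sym; auto|lra].
Qed.

(** The two prefixes change roles. A point s of the cylinder of q must be shown to be a value of g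
    on the cylinder of p: its preimage comes from [follow_onto_atom], and injectivity of [follow] on
    the cylinder of q identifies the value with s. *)
Lemma prefix_replacing_inv g : line_homeo g -> prefix_replacing g -> prefix_replacing (inv g).
Proof.
  intros hg h t. destruct (h (inv g t)) as [p [q [hp H]]].
  assert (ht : g (inv g t) = t) by (apply inv_right; exact (proj1 (proj2 hg))).
  destruct (H _ hp (same_atom_refl _)) as [h1 h2]. rewrite ht in h1, h2.
  exists q, p. split; auto. intros s hs hat. rewrite h2 in hat.
  destruct (follow_onto_atom p _ _ hp hat) as [u [hu1 [hu2 hu3]]].
  rewrite <- hu2 in hat. destruct (H u hu1 hat) as [h3 h4].
  assert (e : g u = s) by (apply (follow_inj q); auto; congruence).
  rewrite (inv_eq g hg u s e). auto.
Qed.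

(** The prefix added by f and the one removed by g are both addresses of [f t], hence comparable.
    The excess of the longer one is passed to the other end of the composite. *)
Lemma prefix_replacing_mul f g : prefix_replacing f -> prefix_replacing g -> prefix_replacing (mul f g).
Proof.
  intros hf hg t. unfold mul.
  destruct (hf t) as [p [q [hp H]]]. destruct (hg (f t)) as [p' [q' [hp' H']]].
  destruct (H t hp (same_atom_refl _)) as [hq eq].
  destruct (address_comparable q p' (f t) hq hp') as [[e ->]|[e ->]].
  - rewrite has_address_app, eq in hp'. destruct hp' as [_ he].
    (* g removes more than f has added, so the composite must remove the excess e as well. *)
    exists (p ++ e), q'. rewrite has_address_app. split; auto.
    intros s hs hat. rewrite has_address_app in hs. destruct hs as [hs hse].
    rewrite follow_app in hat. rewrite (follow_app p e s) in *.
    (* If e is nonempty, both points lie in the foot named by its first letter. *)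
    assert (hat' : same_atom (follow p t) (follow p s)).
    { destruct e as [|w e]; auto. simpl in he, hse. apply (same_atom_foot w); tauto. }
    destruct (H s hs hat') as [h1 h2].
    destruct (H' (f s)) as [h3 h4].
    + rewrite has_address_app, h2. auto.
    + rewrite !follow_app, eq, h2. auto.
    + split; auto. rewrite h4, follow_app, h2. auto.
  - destruct e as [|w e].
    { rewrite app_nil_r in *. exists p, q'. split; auto. intros s hs hat.
      destruct (H s hs hat) as [h1 h2]. destruct (H' (f s)) as [h3 h4]; auto.
      - rewrite eq, h2. auto.
      - split; auto. congruence. }
    (* g removes only a part of what f has added; the remainder stays behind the new prefix. *)
    exists p, (q' ++ w :: e). split; auto. intros s hs hat.
    destruct (H s hs hat) as [h1 h2].
    pose proof hq as hq0. rewrite has_address_app in hq, h1.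
    destruct hq as [_ hq]. destruct h1 as [h1 h1'].
    assert (hat' : same_atom (follow p' (f t)) (follow p' (f s))).
    { simpl in hq, h1'. apply (same_atom_foot w); tauto. }
    destruct (H' (f s) h1 hat') as [h3 h4].
    rewrite has_address_app, follow_app, h4. rewrite follow_app in h2. auto.
Qed.

Lemma prefix_replacing_gen g : gen (generators M F) g -> prefix_replacing g.
Proof.
  intros hg. induction hg as [|f [v [hv ->]]|f hf IH|f g hf IHf hg IHg].
  - apply prefix_replacing_id.
  - apply prefix_replacing_F; auto.
  - apply prefix_replacing_inv; auto.
    apply (gen_line_homeo (generators M F)); auto. intros h. apply (generators_homeo M l r E F hR).
  - apply prefix_replacing_mul; auto.
Qed.

(* A map that multiplies distances by at least 2 has one fixed point, so a [theta] intertwining the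
   [E v] with such maps cannot be invariant under an element replacing a prefix by a longer one. *)
Lemma gen_faithful (theta : R -> R) (T : nat -> R -> R) g :
  (forall v x y, (v < size M)%nat -> 2 * Rabs (x - y) <= Rabs (T v x - T v y)) ->
  (forall v t, (v < size M)%nat -> l v <= t < r v -> theta (E v t) = T v (theta t)) ->
  (forall v, (v < size M)%nat -> exists s t, l v <= s < r v /\ l v <= t < r v /\ theta s <> theta t) ->
  gen (generators M F) g -> (forall t, theta (g t) = theta t) -> g = idf.
Proof.
  intros hT htheta hnc hg hinv. apply functional_extensionality. intros t. unfold idf.
  apply NNPP. intro hgt.
  assert (hgh : line_homeo g).
  { apply (gen_line_homeo (generators M F)); auto. intros h. apply (generators_homeo M l r E F hR). }
  destruct (last_fixed_point g t hgh hgt) as [c [hct [hgc hmov]]].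
  destruct (prefix_replacing_gen g hg c) as [p [q [hp H]]].
  destruct (H c hp (same_atom_refl _)) as [hq eq]. rewrite hgc in hq, eq.
  set (Tp := fun p x => fold_left (fun y v => T v y) p x).
  assert (hTp : forall p s, has_address p s -> theta (follow p s) = Tp p (theta s)).
  { clear - htheta. induction p as [|v p IH]; intros s hs; auto.
    simpl in *. destruct hs as [hv [hs1 hs2]]. rewrite IH by auto.
    rewrite htheta by auto. auto. }
  (* The point s only guarantees that the letters of p are vertices. *)
  assert (hTe : forall p s x y, has_address p s -> Rabs (x - y) <= Rabs (Tp p x - Tp p y)).
  { clear - hT. induction p as [|v p IH]; intros s x y hs; simpl.
    - lra.
    - simpl in hs. destruct hs as [hv [hs1 hs2]].
      specialize (IH _ (T v x) (T v y) hs2). specialize (hT v x y hv).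
      pose proof (Rabs_pos (x - y)). unfold Tp in *. simpl. lra. }
  assert (hfix : forall v e s, has_address (v :: e) s ->
    ~ (forall z, l v <= z < r v -> Tp (v :: e) (theta z) = theta z)).
  { intros v e s hs hz. simpl in hs. destruct hs as [hv [hs1 hs2]].
    destruct (hnc v hv) as [x [y [hx [hy ne]]]].
    pose proof (hTe e _ (T v (theta x)) (T v (theta y)) hs2) as h1.
    pose proof (hT v (theta x) (theta y) hv) as h2.
    pose proof (hz x hx) as ex. pose proof (hz y hy) as ey. unfold Tp in *. simpl in ex, ey.
    rewrite ex, ey in h1.
    assert (0 < Rabs (theta x - theta y)) by (apply Rabs_pos_lt; lra). lra. }
  destruct (address_comparable p q c hp hq) as [[e ->]|[e ->]].
  - destruct e as [|v e].
    (* Equal prefixes: [follow p] is injective on the cylinder, so g fixes points just to the right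
       of c, which were chosen to move. *)
    + rewrite app_nil_r in *.
      destruct (address_right_nbhd p c hp) as [eps [he Heps]].
      set (s := c + Rmin eps (t - c) / 2).
      pose proof (Rmin_l eps (t - c)). pose proof (Rmin_r eps (t - c)).
      assert (0 < Rmin eps (t - c)) by (apply Rmin_pos; lra).
      destruct (Heps s ltac:(unfold s; lra)) as [h1 h2].
      destruct (H s h1 h2) as [h3 h4].
      apply (hmov s); [unfold s; lra|]. apply (follow_inj p); auto.
    + rewrite has_address_app in hq. destruct hq as [_ hq].
      (* Each z in foot v is [follow p s] for some s in the cylinder. Invariance of theta gives z
         and [follow p (g s)] the same theta value, and following [v :: e] from the latter leads
         back to z. *)
      apply (hfix v e _ hq). intros z hz.
      simpl in hq. destruct hq as [hv [hc _]].
      destruct (follow_onto_atom p c z hp) as [s [h1 [h2 _]]].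
      { apply (same_atom_foot v); auto. }
      destruct (H s h1) as [h3 h4]; [rewrite h2; apply (same_atom_foot v); auto|].
      rewrite has_address_app in h3. destruct h3 as [h3 h5].
      rewrite follow_app, h2 in h4.
      rewrite <- h4 at 2. rewrite hTp by auto. rewrite (hTp p (g s)) by auto.
      rewrite hinv. rewrite <- (hTp p s) by auto. rewrite h2. auto.
  - destruct e as [|v e].
    + rewrite app_nil_r in *.
      destruct (address_right_nbhd q c hp) as [eps [he Heps]].
      set (s := c + Rmin eps (t - c) / 2).
      pose proof (Rmin_l eps (t - c)). pose proof (Rmin_r eps (t - c)).
      assert (0 < Rmin eps (t - c)) by (apply Rmin_pos; lra).
      destruct (Heps s ltac:(unfold s; lra)) as [h1 h2].
      destruct (H s h1 h2) as [h3 h4].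
      apply (hmov s); [unfold s; lra|]. apply (follow_inj q); auto.
    + pose proof hp as hp0. rewrite has_address_app in hp. destruct hp as [_ hp].
      (* Now z is reached from [follow q s] by [v :: e] and also equals [follow q (g s)]; invariance
         makes [theta z] a fixed point of the same composite. *)
      apply (hfix v e _ hp). intros z hz.
      simpl in hp. destruct hp as [hv [hc _]].
      destruct (follow_onto_atom (q ++ v :: e) c z hp0) as [s [h1 [h2 _]]].
      { rewrite <- eq. apply (same_atom_foot v); auto. }
      destruct (H s h1) as [h3 h4]; [rewrite h2, <- eq; apply (same_atom_foot v); auto|].
      rewrite h2 in h4.
      assert (ez : theta z = Tp q (theta s)).
      { rewrite <- (hinv s), <- hTp by auto. congruence. }
      rewrite has_address_app in h1. destruct h1 as [h1 h1'].
      rewrite follow_app in h2.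
      rewrite <- h2 at 2. rewrite hTp by auto. rewrite (hTp q) by auto. congruence.
Qed.

End Addresses.

(** * The semiconjugacy *)

Fixpoint sum_below (f : nat -> R) (k : nat) : R :=
  match k with O => 0 | S k => sum_below f k + f k end.

Section Semiconjugacy.

Context (M : matching) (hM : is_matching M) (l r : nat -> R) (E F : nat -> R -> R)
  (hR : realizes M l r E F).

(* The feet of the target are [L v, Q v), and [G v] contracts the image of foot [v] onto it. *)
Context (L Q : nat -> R) (G : nat -> R -> R)
  (hL0 : L 0%nat = 0) (hL1 : L (size M) = 1)
  (hLQ : forall v, (v < size M)%nat -> L v < Q v)
  (hQL : forall v, (v < size M)%nat -> Q v <= L (S v))
  (hgap : forall v, (v < size M)%nat -> Q v < L (S v) -> partner M v = S v)
  (hGc : forall v, (v < size M)%nat -> continuity (G v))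
  (hGi : forall v, (v < size M)%nat -> increasing (G v))
  (hGh : forall v x y, (v < size M)%nat -> Rabs (G v x - G v y) <= Rabs (x - y) / 2)
  (hG1 : forall v, opening M v -> G v (L v) = L v)
  (hG2 : forall v, opening M v -> G v (L (partner M v)) = Q v)
  (hG3 : forall v, opening M v -> G (partner M v) (Q v) = L (partner M v))
  (hG4 : forall v, opening M v -> G (partner M v) (Q (partner M v)) = Q (partner M v)).

(** A target gap occurs only between the adjacent feet of one bump. There the source has a gap as
    well, which a continuous theta can stretch over it. *)
Lemma source_gap v : (v < size M)%nat -> Q v < L (S v) -> (S v < size M)%nat /\ r v < l (S v).
Proof.
  intros hv h. pose proof (hgap v hv h) as e. pose proof (partner_lt M hM v hv).
  assert (ho : opening M v) by (split; lia).
  pose proof (opening_order M hM l r E F hR v ho). rewrite e in *. tauto.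
Qed.

(** A linear ramp over the source gap. If the target has no gap the first factor vanishes, which
    covers a zero denominator and the case where [S v] is not a vertex. *)
Definition gap_part (v : nat) (t : R) : R :=
  (L (S v) - Q v) * clamp 0 1 ((t - r v) / (l (S v) - r v)).

Lemma gap_part_cases v : (v < size M)%nat ->
  (L (S v) - Q v = 0 /\ forall t, gap_part v t = 0) \/
  (0 < L (S v) - Q v /\ (S v < size M)%nat /\ 0 < l (S v) - r v).
Proof.
  intros hv. destruct (hQL v hv) as [h|h].
  - right. destruct (source_gap v hv h). split; [lra|]. split; auto; lra.
  - left. split; [lra|]. intros t. unfold gap_part. rewrite h. ring.
Qed.

Lemma gap_part_lo v t : (v < size M)%nat -> t <= r v -> gap_part v t = 0.
Proof.
  intros hv ht. destruct (gap_part_cases v hv) as [[_ h]|[h1 [h2 h3]]]; auto.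
  unfold gap_part. rewrite clamp_lo; [ring|lra|].
  pose proof (Rinv_0_lt_compat _ h3). unfold Rdiv. nra.
Qed.

Lemma gap_part_hi v t : (v < size M)%nat -> ((S v < size M)%nat -> l (S v) <= t) ->
  gap_part v t = L (S v) - Q v.
Proof.
  intros hv ht. destruct (gap_part_cases v hv) as [[h0 h]|[h1 [h2 h3]]].
  - rewrite h; auto.
  - specialize (ht h2). unfold gap_part. rewrite clamp_hi; [ring|lra|].
    apply Rmult_le_reg_r with (l (S v) - r v); auto. unfold Rdiv.
    rewrite Rmult_assoc, Rinv_l by lra. lra.
Qed.

Lemma gap_part_increasing v : (v < size M)%nat -> increasing (gap_part v).
Proof.
  intros hv s t hst. destruct (gap_part_cases v hv) as [[_ h]|[h1 [h2 h3]]].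
  - rewrite !h. lra.
  - unfold gap_part. apply Rmult_le_compat_l; [lra|]. apply clamp_increasing.
    unfold Rdiv. apply Rmult_le_compat_r; [|lra]. left. apply Rinv_0_lt_compat; auto.
Qed.

Lemma gap_part_continuity v : continuity (gap_part v).
Proof.
  unfold gap_part.
  apply (continuity_mult (fun _ => L (S v) - Q v)
    (fun t => clamp 0 1 ((t - r v) / (l (S v) - r v)))).
  - apply continuity_const. intros ? ?; auto.
  - apply (continuity_comp (fun t => (t - r v) / (l (S v) - r v)) (clamp 0 1)).
    + unfold Rdiv. apply (continuity_mult (fun t => t - r v) (fun _ => / (l (S v) - r v))).
      * apply (continuity_minus (fun t => t) (fun _ => r v)).
        -- apply derivable_continuous, derivable_id.
        -- apply continuity_const. intros ? ?; auto.
      * apply continuity_const. intros ? ?; auto.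
    + apply clamp_continuity.
Qed.

(** * Gluing maps of the feet into a map of the line *)

Definition foot_maps (H : nat -> R -> R) : Prop :=
  forall v, (v < size M)%nat ->
    continuity (H v) /\ increasing (H v) /\ H v (l v) = L v /\ H v (r v) = Q v.

(** The increment of the glued map over one cell: 0 before the foot and L (S v) - L v from the next
    foot on, so that the sum telescopes. *)
Definition cell_part (H : nat -> R -> R) (v : nat) (t : R) : R :=
  H v (clamp (l v) (r v) t) - L v + gap_part v t.

(* Written as a sum of clamped terms so that continuity and
   monotonicity need no case analysis at the break points. *)
Definition glue (H : nat -> R -> R) (t : R) : R := sum_below (fun v => cell_part H v t) (size M).

Section Glue.

Context (H : nat -> R -> R) (hH : foot_maps H).

Lemma cell_part_continuity v : (v < size M)%nat -> continuity (cell_part H v).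
Proof.
  intros hv. destruct (hH v hv) as [h1 _].
  apply (continuity_plus (fun t => H v (clamp (l v) (r v) t) - L v) (gap_part v)).
  - apply (continuity_minus (fun t => H v (clamp (l v) (r v) t)) (fun _ => L v)).
    + apply (continuity_comp (clamp (l v) (r v)) (H v)); auto. apply clamp_continuity.
    + apply continuity_const. intros ? ?; auto.
  - apply gap_part_continuity.
Qed.

Lemma cell_part_increasing v : (v < size M)%nat -> increasing (cell_part H v).
Proof.
  intros hv s t hst. destruct (hH v hv) as [_ [h2 _]]. unfold cell_part.
  pose proof (gap_part_increasing v hv s t hst).
  pose proof (h2 _ _ (clamp_increasing (l v) (r v) s t hst)). lra.
Qed.

Lemma cell_part_lo v t : (v < size M)%nat -> t <= l v -> cell_part H v t = 0.
Proof.
  intros hv ht. destruct (hH v hv) as [_ [_ [h3 _]]].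
  pose proof (foot_lt _ _ _ _ _ hR v hv). unfold cell_part.
  rewrite gap_part_lo by (auto; lra). rewrite clamp_lo by lra. lra.
Qed.

Lemma cell_part_hi v t : (v < size M)%nat -> r v <= t -> ((S v < size M)%nat -> l (S v) <= t) ->
  cell_part H v t = L (S v) - L v.
Proof.
  intros hv h1 h2. destruct (hH v hv) as [_ [_ [_ h4]]].
  pose proof (foot_lt _ _ _ _ _ hR v hv). unfold cell_part.
  rewrite gap_part_hi by auto. rewrite clamp_hi by lra. lra.
Qed.

Lemma cell_part_foot v t : (v < size M)%nat -> l v <= t <= r v -> cell_part H v t = H v t - L v.
Proof.
  intros hv ht. unfold cell_part. rewrite gap_part_lo by (auto; lra). rewrite clamp_mid by auto. ring.
Qed.

Lemma glue_foot v t : (v < size M)%nat -> l v <= t <= r v -> glue H t = H v t.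
Proof.
  intros hv ht.
  (* Cells before v are complete at t and telescope to [L k]; in [B], cells after v have not
     started. *)
  assert (A : forall k, (k <= v)%nat -> sum_below (fun v => cell_part H v t) k = L k).
  { induction k as [|k IH]; intros hk; simpl; auto.
    rewrite IH by lia.
    assert (r k <= l v) by (apply (foot_sep _ _ _ _ _ hR); auto).
    assert (l (S k) <= l v).
    { destruct (Nat.eq_dec (S k) v) as [->|]; [lra|].
      left. apply (l_lt M l r E F hR); auto; lia. }
    rewrite cell_part_hi; [lra|lia|lra|intros; lra]. }
  assert (B : forall k, (v < k)%nat -> (k <= size M)%nat ->
    sum_below (fun v => cell_part H v t) k = H v t).
  { induction k as [|k IH]; intros hk1 hk2; [lia|]. simpl.
    destruct (Nat.eq_dec k v) as [->|].
    - rewrite A, cell_part_foot by (auto; lia). ring.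
    - assert (r v <= l k) by (apply (foot_sep _ _ _ _ _ hR); lia).
      rewrite IH, cell_part_lo by (lia || lra). ring. }
  apply B; auto.
Qed.

Lemma glue_continuity : continuity (glue H).
Proof.
  (* Only the summation bound is generalized. It remains bounded by [size M], so each index met in
     the induction is a vertex. *)
  unfold glue. assert (h : (size M <= size M)%nat) by lia. revert h.
  generalize (size M) at 1 3. induction n as [|k IH]; intros hk; simpl.
  - apply continuity_const. intros ? ?; auto.
  - apply (continuity_plus (fun t => sum_below (fun v => cell_part H v t) k) (cell_part H k)).
    + apply IH; lia.
    + apply cell_part_continuity; lia.
Qed.

Lemma glue_increasing : increasing (glue H).
Proof.
  unfold glue. assert (h : (size M <= size M)%nat) by lia. revert h.
  generalize (size M) at 1 3. induction n as [|k IH]; intros hk s t hst; simpl; [lra|].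
  pose proof (IH ltac:(lia) s t hst). pose proof (cell_part_increasing k ltac:(lia) s t hst).
  simpl in *. lra.
Qed.

(** By monotonicity cell k contributes between 0 and L (S k) - L k, and the latter add up to L (size
    M) = 1. *)
Lemma glue_range t : 0 <= glue H t <= 1.
Proof.
  rewrite <- hL1. unfold glue. assert (h : (size M <= size M)%nat) by lia. revert h.
  generalize (size M) at 1 3 4 5. induction n as [|k IH]; intros hk; simpl; [lra|].
  specialize (IH ltac:(lia)).
  assert (hv : (k < size M)%nat) by lia.
  pose proof (foot_lt _ _ _ _ _ hR k hv).
  assert (0 <= cell_part H k t).
  { rewrite <- (cell_part_lo k (Rmin t (l k)) hv (Rmin_r _ _)).
    apply cell_part_increasing; auto. apply Rmin_l. }
  assert (cell_part H k t <= L (S k) - L k).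
  { rewrite <- (cell_part_hi k (Rmax t (Rmax (r k) (l (S k)))) hv).
    - apply cell_part_increasing; auto. apply Rmax_l.
    - eapply Rle_trans; [|apply Rmax_r]. apply Rmax_l.
    - intros _. eapply Rle_trans; [|apply Rmax_r]. apply Rmax_r. }
  lra.
Qed.

End Glue.

(** Off the feet the clamped arguments are ends of feet, where both families have the same
    prescribed values. So the distance is governed by the feet alone. *)
Lemma glue_close H H' c t : foot_maps H -> foot_maps H' -> 0 <= c ->
  (forall v, (v < size M)%nat -> l v <= t <= r v -> Rabs (H v t - H' v t) <= c) ->
  Rabs (glue H t - glue H' t) <= c.
Proof.
  intros hH hH' hc hd.
  destruct (classic (exists v, (v < size M)%nat /\ l v <= t <= r v)) as [[v [hv ht]]|no].
  - rewrite (glue_foot H hH v), (glue_foot H' hH' v); auto.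
  - replace (glue H t) with (glue H' t); [rewrite Rminus_diag, Rabs_R0; auto|].
    unfold glue. assert (h : (size M <= size M)%nat) by lia. revert h.
    generalize (size M) at 1 3 4. induction n as [|k IH]; intros hk; simpl; auto.
    rewrite IH by lia. f_equal. unfold cell_part. do 2 f_equal.
    assert (hv : (k < size M)%nat) by lia.
    destruct (hH k hv) as [_ [_ [h3 h4]]]. destruct (hH' k hv) as [_ [_ [h3' h4']]].
    pose proof (foot_lt _ _ _ _ _ hR k hv).
    destruct (Rle_lt_dec t (l k)).
    + rewrite clamp_lo by lra. congruence.
    + rewrite clamp_hi; [congruence|lra|].
      apply Rnot_lt_le. intro. apply no. exists k. split; auto; lra.
Qed.

(** * The fixed point of the contraction, by iteration *)

Definition admissible (th : R -> R) : Prop :=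
  continuity th /\ increasing th /\
  forall v, (v < size M)%nat -> th (l v) = L v /\ th (r v) = Q v.

Lemma glue_admissible H : foot_maps H -> admissible (glue H).
Proof.
  intros hH. split; [apply glue_continuity; auto|]. split; [apply glue_increasing; auto|].
  intros v hv. destruct (hH v hv) as [_ [_ [h3 h4]]]. pose proof (foot_lt _ _ _ _ _ hR v hv).
  rewrite !(glue_foot H hH v) by (auto; lra). auto.
Qed.

(** [E v] sends the ends of its foot to ends of feet, where th is prescribed; [hG1] to [hG4] say
    that [G v] brings these values back to [L v] and [Q v]. *)
Lemma pullback_foot_maps th : admissible th -> foot_maps (fun v t => G v (th (E v t))).
Proof.
  intros [h1 [h2 h3]] v hv. pose proof (E_homeo _ _ _ _ _ hR v hv) as hE. split; [|split].
  - apply (continuity_comp (fun t => th (E v t)) (G v)); auto.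
    apply (continuity_comp (E v) th); auto. apply line_homeo_continuity; auto.
  - intros s t hst. apply hGi; auto. apply h2.
    apply (strict_increasing_le _ (proj1 hE)); auto.
  - destruct (opening_cases M v hM hv) as [ho|ho].
    + pose proof (opening_partner_lt M v hM ho) as hp.
      rewrite (E_l M l r E F hR v ho), (E_mid _ _ _ _ _ hR v ho).
      rewrite (proj1 (h3 v hv)), (proj1 (h3 _ hp)). auto.
    + pose proof (proj1 ho) as hp. pose proof (E_partner_l M l r E F hR _ ho) as e1.
      pose proof (E_partner_off M l r E F hR _ (r v) ho) as e2.
      pose proof (hG3 _ ho) as e3. pose proof (hG4 _ ho) as e4.
      rewrite (partnerK M hM v hv) in *.
      rewrite e1, e2 by lra. rewrite (proj2 (h3 v hv)), (proj2 (h3 _ hp)). auto.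
Qed.

Lemma affine_foot_maps :
  foot_maps (fun v t => L v + (Q v - L v) * ((t - l v) / (r v - l v))).
Proof.
  intros v hv. pose proof (foot_lt _ _ _ _ _ hR v hv) as h. pose proof (hLQ v hv).
  pose proof (Rinv_0_lt_compat (r v - l v) ltac:(lra)).
  split; [|split; [|split]].
  - apply derivable_continuous. intros t. unfold Rdiv. reg.
  - intros s t hst. apply Rplus_le_compat_l, Rmult_le_compat_l; [lra|].
    unfold Rdiv. apply Rmult_le_compat_r; lra.
  - field. lra.
  - field. lra.
Qed.

Fixpoint theta_iter (k : nat) : R -> R :=
  match k with
  | O => glue (fun v t => L v + (Q v - L v) * ((t - l v) / (r v - l v)))
  | S k => glue (fun v t => G v (theta_iter k (E v t)))
  end.

Lemma theta_iter_admissible k : admissible (theta_iter k).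
Proof.
  induction k; simpl; apply glue_admissible.
  - apply affine_foot_maps.
  - apply pullback_foot_maps; auto.
Qed.

Lemma theta_iter_range k t : 0 <= theta_iter k t <= 1.
Proof.
  destruct k; simpl; apply glue_range.
  - apply affine_foot_maps.
  - apply pullback_foot_maps, theta_iter_admissible.
Qed.

(** The first step is at most 1 since all values lie in [0,1]. Each later step is halved by [G] on
    the feet, and [glue_close] spreads the bound to the line. *)
Lemma theta_iter_step k t : Rabs (theta_iter (S k) t - theta_iter k t) <= (/ 2) ^ k.
Proof.
  revert t. induction k as [|k IH]; intros t.
  - pose proof (theta_iter_range 1 t). pose proof (theta_iter_range 0 t).
    simpl pow. apply Rabs_le. lra.
  - change (theta_iter (S (S k))) with (glue (fun v t => G v (theta_iter (S k) (E v t)))).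
    change (theta_iter (S k) t) with (glue (fun v t => G v (theta_iter k (E v t))) t).
    apply glue_close.
    + apply pullback_foot_maps, theta_iter_admissible.
    + apply pullback_foot_maps, theta_iter_admissible.
    + apply pow_le. lra.
    + intros v hv _. eapply Rle_trans; [apply hGh; auto|].
      pose proof (IH (E v t)). simpl pow. lra.
Qed.

Lemma theta_iter_tail k j t : Rabs (theta_iter (k + j) t - theta_iter k t) <= 2 * (/ 2) ^ k.
Proof.
  (* The partial geometric sum is kept exact, because the final bound alone is not inductive. *)
  assert (Rabs (theta_iter (k + j) t - theta_iter k t) <= 2 * (/ 2) ^ k - 2 * (/ 2) ^ (k + j)).
  { induction j as [|j IH].
    - rewrite Nat.add_0_r, Rminus_diag, Rabs_R0. lra.
    - rewrite Nat.add_succ_r. pose proof (theta_iter_step (k + j) t) as h.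
      replace (theta_iter (S (k + j)) t - theta_iter k t) with
        ((theta_iter (S (k + j)) t - theta_iter (k + j) t) + (theta_iter (k + j) t - theta_iter k t)) by ring.
      eapply Rle_trans; [apply Rabs_triang|]. simpl pow. lra. }
  pose proof (pow_lt (/ 2) (k + j) ltac:(lra)). lra.
Qed.

Lemma half_pow_small eps : eps > 0 -> exists k, (/ 2) ^ k < eps.
Proof.
  intros he. destruct (pow_lt_1_zero (/ 2)) with (y := eps) as [k hk]; auto.
  - rewrite Rabs_right; lra.
  - exists k. specialize (hk k ltac:(lia)). rewrite Rabs_right in hk; auto.
    apply Rle_ge, pow_le. lra.
Qed.

Lemma theta_limit t : exists x, forall k, Rabs (theta_iter k t - x) <= 2 * (/ 2) ^ k.
Proof.
  destruct (R_complete (fun k => theta_iter k t)) as [x hx].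
  - intros eps he. destruct (half_pow_small (eps / 4) ltac:(lra)) as [k hk].
    exists k. intros i j hi hj.
    pose proof (theta_iter_tail k (i - k) t) as h1. pose proof (theta_iter_tail k (j - k) t) as h2.
    replace (k + (i - k))%nat with i in h1 by lia. replace (k + (j - k))%nat with j in h2 by lia.
    unfold R_dist.
    replace (theta_iter i t - theta_iter j t) with
      ((theta_iter i t - theta_iter k t) - (theta_iter j t - theta_iter k t)) by ring.
    revert h1 h2. split_Rabs; lra.
  - exists x. intros k. apply Rle_plus_epsilon. intros eps he.
    destruct (hx eps he) as [N hN]. specialize (hN (k + N)%nat ltac:(lia)).
    pose proof (theta_iter_tail k N t) as h. unfold R_dist in hN.
    revert hN h. split_Rabs; lra.
Qed.

(** The factor 4 leaves room for two errors of size 2 * (/ 2) ^ k each. *)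
Lemma eq_of_close x y : (forall k, Rabs (x - y) <= 4 * (/ 2) ^ k) -> x = y.
Proof.
  intros h. destruct (Req_dec x y) as [|ne]; auto. exfalso.
  assert (0 < Rabs (x - y)) by (apply Rabs_pos_lt; lra).
  destruct (half_pow_small (Rabs (x - y) / 4) ltac:(lra)) as [k hk].
  specialize (h k). lra.
Qed.

Lemma semiconjugacy_exists : exists th, admissible th /\ (forall t, 0 <= th t <= 1) /\
  forall v t, (v < size M)%nat -> l v <= t <= r v -> th t = G v (th (E v t)).
Proof.
  assert (hex : exists th : R -> R, forall t k, Rabs (theta_iter k t - th t) <= 2 * (/ 2) ^ k).
  { exists (fun t => epsilon (inhabits 0) (fun x => forall k, Rabs (theta_iter k t - x) <= 2 * (/ 2) ^ k)).
    intros t. apply epsilon_spec. apply theta_limit. }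
  destruct hex as [th hth]. exists th.
  assert (happrox : forall eps, eps > 0 -> exists k, forall t, Rabs (theta_iter k t - th t) < eps).
  { intros eps he. destruct (half_pow_small (eps / 2) ltac:(lra)) as [k hk].
    exists k. intros t. specialize (hth t k). lra. }
  split; [split; [|split]|split].
  - apply continuityE. intros x eps he. destruct (happrox (eps / 3) ltac:(lra)) as [k hk].
    pose proof (proj1 (theta_iter_admissible k)) as hc. rewrite continuityE in hc.
    destruct (hc x (eps / 3) ltac:(lra)) as [d [hd Hd]]. exists d; split; auto.
    intros y hy. specialize (Hd y hy). pose proof (hk x) as h1. pose proof (hk y) as h2.
    revert Hd h1 h2. split_Rabs; lra.
  - intros s t hst. apply Rle_plus_epsilon. intros eps he.
    destruct (happrox (eps / 2) ltac:(lra)) as [k hk].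
    pose proof (proj1 (proj2 (theta_iter_admissible k)) s t hst).
    pose proof (hk s) as h1. pose proof (hk t) as h2. revert h1 h2. split_Rabs; lra.
  - intros v hv. split; apply eq_of_close; intros k;
    destruct (proj2 (proj2 (theta_iter_admissible k)) v hv) as [e1 e2].
    + pose proof (hth (l v) k) as h. rewrite e1 in h. rewrite Rabs_minus_sym in h.
      pose proof (pow_lt (/ 2) k ltac:(lra)). lra.
    + pose proof (hth (r v) k) as h. rewrite e2 in h. rewrite Rabs_minus_sym in h.
      pose proof (pow_lt (/ 2) k ltac:(lra)). lra.
  - intros t. split; apply Rle_plus_epsilon; intros eps he; destruct (happrox eps he) as [k hk];
    pose proof (hk t) as h; pose proof (theta_iter_range k t); revert h; split_Rabs; lra.
  (* Iterate k + 1 at t is compared with iterate k at [E v t]: half of the error 2 * (/ 2) ^ k on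
     either side. *)
  - intros v t hv ht. apply eq_of_close. intros k.
    pose proof (hth t (S k)) as h1. pose proof (hth (E v t) k) as h2.
    assert (e : theta_iter (S k) t = G v (theta_iter k (E v t))).
    { simpl. rewrite (glue_foot _ (pullback_foot_maps _ (theta_iter_admissible k)) v); auto. }
    rewrite e in h1. pose proof (hGh v (theta_iter k (E v t)) (th (E v t)) hv) as h3.
    simpl pow in h1. pose proof (pow_lt (/ 2) k ltac:(lra)).
    revert h1 h2 h3. split_Rabs; lra.
Qed.

End Semiconjugacy.

(** * From the equation on feet to equivariance under the generators *)

Section Intertwining.

Context (M : matching) (hM : is_matching M) (l r : nat -> R) (E F : nat -> R -> R)
  (hR : realizes M l r E F) (l' r' : nat -> R) (E' F' : nat -> R -> R)
  (hR' : realizes M l' r' E' F') (th : R -> R) (hth : increasing th)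
  (hl : forall v, (v < size M)%nat -> th (l v) = l' v)
  (hr : forall v, (v < size M)%nat -> th (r v) = r' v)
  (hE : forall v t, (v < size M)%nat -> l v <= t <= r v -> th (E v t) = E' v (th t)).

(** Beyond the foot of v, the point [E v t] lies in the partner foot, whose expanding map returns it
    to t. The hypothesis there, inverted, is the claim. *)
Lemma intertwine_opening v t : opening M v -> l v <= t <= r (partner M v) -> th (E v t) = E' v (th t).
Proof.
  intros hv ht. pose proof (opening_partner_lt M v hM hv) as hp. pose proof (proj1 hv) as hv1.
  pose proof (opening_order M hM l r E F hR v hv).
  destruct (Rle_lt_dec t (r v)) as [h|h]; [apply hE; auto; lra|].
  assert (h' : l (partner M v) <= E v t <= r (partner M v)).
  { pose proof (strict_increasing_le _ (E_increasing M l r E F hR v hv1)) as hi.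
    rewrite <- (E_mid _ _ _ _ _ hR v hv) at 1. rewrite <- (E_r M l r E F hR v hv).
    split; apply hi; lra. }
  pose proof (hE _ _ hp h') as e. rewrite (E_partner _ _ _ _ _ hR) in e by auto.
  rewrite e. rewrite (partner_E M hM l' r' E' F' hR'); auto.
Qed.

Lemma intertwine_partner v t : opening M v -> l v <= t <= r (partner M v) ->
  th (E (partner M v) t) = E' (partner M v) (th t).
Proof.
  intros hv ht. pose proof (opening_partner_lt M v hM hv) as hp. pose proof (proj1 hv) as hv1.
  assert (h' : l v <= E (partner M v) t <= r (partner M v)).
  { pose proof (strict_increasing_le_inv _ (E_increasing M l r E F hR v hv1)) as hi.
    split; apply hi; rewrite (partner_E M hM l r E F hR) by auto.
    - rewrite (E_l M l r E F hR v hv). lra.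
    - rewrite (E_r M l r E F hR v hv). lra. }
  pose proof (intertwine_opening v _ hv h') as e. rewrite (partner_E M hM l r E F hR) in e by auto.
  rewrite e. rewrite (E_partner _ _ _ _ _ hR'); auto.
Qed.

Lemma intertwine_F lam t : th (F lam t) = F' lam (th t).
Proof.
  destruct (classic (exists v, opening M v /\ label M v = lam /\ l v < t < r (partner M v)))
    as [[v [hv [<- ht]]]|no].
  - pose proof (opening_partner_lt M v hM hv) as hp. pose proof (proj1 hv) as hv1.
    rewrite (F_on _ _ _ _ _ hR v t hv) by lra.
    (* th is only weakly increasing, so [th t] may reach an end of the orbital; [F_on] is stated on
       the closed orbital for this. *)
    rewrite (F_on _ _ _ _ _ hR' v _ hv).
    2:{ rewrite <- hl, <- hr by auto. split; apply hth; lra. }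
    destruct (rising M v); [apply intertwine_opening | apply intertwine_partner]; auto; lra.
  - rewrite (F_off _ _ _ _ _ hR), (F_off _ _ _ _ _ hR'); auto.
    + intros v hv e ht. pose proof (opening_partner_lt M v hM hv) as hp. pose proof (proj1 hv) as hv1.
      apply no. exists v. split; auto. split; auto.
      rewrite <- hl, <- hr in ht by auto.
      split; apply Rnot_le_lt; intro c; apply hth in c; lra.
    + intros v hv e ht. apply no. eauto.
Qed.

End Intertwining.

(** * The piecewise linear model *)

(** Each affine piece is written from the end that it fixes, which matches [expand] below.
    Exchanging m and m' gives the inverse. *)
Definition kink (x m y m' t : R) : R :=
  if Rle_dec t x then t
  else if Rle_dec t m then x + (t - x) * ((m' - x) / (m - x))
  else if Rle_dec t y then y + (t - y) * ((y - m') / (y - m))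
  else t.

Lemma kink_off x m y m' t : x < m < y -> ~ (x < t < y) -> kink x m y m' t = t.
Proof.
  intros h ht. unfold kink. destruct (Rle_dec t x); auto.
  destruct (Rle_dec t m); [lra|]. destruct (Rle_dec t y); auto.
  replace t with y by lra. field. lra.
Qed.

Lemma kink_left x m y m' t : x < m -> x <= t <= m ->
  kink x m y m' t = x + (t - x) * ((m' - x) / (m - x)).
Proof.
  intros h ht. unfold kink. destruct (Rle_dec t x).
  - replace t with x by lra. field. lra.
  - destruct (Rle_dec t m); [auto|lra].
Qed.

Lemma kink_right x m y m' t : x < m < y -> m <= t <= y ->
  kink x m y m' t = y + (t - y) * ((y - m') / (y - m)).
Proof.
  intros h ht. unfold kink. destruct (Rle_dec t x); [lra|].
  destruct (Rle_dec t m).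
  - replace t with m by lra. field. lra.
  - destruct (Rle_dec t y); [auto|lra].
Qed.

Lemma kink_mid x m y m' : x < m < y -> kink x m y m' m = m'.
Proof. intros h. rewrite kink_left by lra. field. lra. Qed.

Lemma ratio_pos a b : 0 < a -> 0 < b -> 0 < a / b.
Proof. intros. apply Rdiv_pos_pos; auto. Qed.

Lemma kink_increasing x m y m' : x < m < y -> x < m' < y -> strict_increasing (kink x m y m').
Proof.
  intros h h' s t hst.
  assert (hl : forall u v, x <= u -> v <= m -> u < v -> kink x m y m' u < kink x m y m' v).
  { intros u v hu hv huv. rewrite !kink_left by lra.
    pose proof (ratio_pos (m' - x) (m - x) ltac:(lra) ltac:(lra)). nra. }
  assert (hr : forall u v, m <= u -> v <= y -> u < v -> kink x m y m' u < kink x m y m' v).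
  { intros u v hu hv huv. rewrite !kink_right by lra.
    pose proof (ratio_pos (y - m') (y - m) ltac:(lra) ltac:(lra)). nra. }
  assert (hin : forall u v, x <= u -> v <= y -> u < v -> kink x m y m' u < kink x m y m' v).
  { intros u v hu hv huv. destruct (Rle_lt_dec v m); [apply hl; auto|].
    destruct (Rle_lt_dec m u); [apply hr; auto|].
    apply Rlt_trans with (kink x m y m' m); [apply hl|apply hr]; lra. }
  assert (ex : kink x m y m' x = x) by (apply kink_off; lra).
  assert (ey : kink x m y m' y = y) by (apply kink_off; lra).
  destruct (Rlt_le_dec s x); destruct (Rlt_le_dec y t);
  destruct (Rle_lt_dec t x); destruct (Rle_lt_dec y s);
  try (rewrite (kink_off x m y m' s) by lra); try (rewrite (kink_off x m y m' t) by lra); try lra.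
  - assert (kink x m y m' x < kink x m y m' t) by (apply hin; lra). lra.
  - assert (kink x m y m' s < kink x m y m' y) by (apply hin; lra). lra.
  - apply hin; lra.
Qed.

Lemma kinkK x m y m' t : x < m < y -> x < m' < y -> kink x m' y m (kink x m y m' t) = t.
Proof.
  intros h h'. pose proof (kink_increasing x m y m' h h') as hi.
  pose proof (strict_increasing_le _ hi) as hi'.
  assert (ex : kink x m y m' x = x) by (apply kink_off; lra).
  assert (ey : kink x m y m' y = y) by (apply kink_off; lra).
  pose proof (kink_mid x m y m' h) as em.
  destruct (classic (x < t < y)) as [ht|ht].
  2:{ rewrite (kink_off x m y m' t) by auto. apply kink_off; auto. }
  destruct (Rle_lt_dec t m).
  - rewrite (kink_left x m' y m).
    + rewrite kink_left by lra. field. lra.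
    + lra.
    + assert (kink x m y m' x <= kink x m y m' t <= kink x m y m' m) by (split; apply hi'; lra). lra.
  - rewrite (kink_right x m' y m); auto.
    + rewrite kink_right by lra. field. lra.
    + assert (kink x m y m' m <= kink x m y m' t <= kink x m y m' y) by (split; apply hi'; lra). lra.
Qed.

Lemma kink_line_homeo x m y m' : 0 <= x -> y <= 1 -> x < m < y -> x < m' < y ->
  line_homeo (kink x m y m').
Proof.
  intros h0 h1 h h'. split; [apply kink_increasing; auto|]. split.
  - intros t. exists (kink x m' y m t). apply kinkK; auto.
  - intros t ht. apply kink_off; auto. lra.
Qed.

(** The slope exceeds 1 on the piece fixing x and is below 1 on the piece fixing y; both push to the
    right. *)
Lemma kink_pos x m y m' t : x < m < y -> m < m' < y -> x < t < y -> t < kink x m y m' t.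
Proof.
  intros h h' ht. destruct (Rle_lt_dec t m).
  - rewrite kink_left by lra.
    assert (1 < (m' - x) / (m - x)).
    { apply Rmult_lt_reg_r with (m - x); [lra|]. unfold Rdiv. rewrite Rmult_assoc, Rinv_l; lra. }
    nra.
  - rewrite kink_right by lra.
    assert ((y - m') / (y - m) < 1).
    { apply Rmult_lt_reg_r with (y - m); [lra|]. unfold Rdiv. rewrite Rmult_assoc, Rinv_l; lra. }
    nra.
Qed.

Section Model.

Context (M : matching) (hM : is_matching M) (hsize : (0 < size M)%nat)
  (hsep : forall v w, opening M v -> opening M w -> label M v = label M w ->
    (v < w)%nat -> (partner M v < w)%nat).

(* The interval is cut into equal cells, one for each foot, plus one between the two feet of a bump
   with adjacent feet, since those must not touch. *)
Fixpoint cell (v : nat) : nat :=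
  match v with
  | O => O
  | S v => (cell v + 1 + if Nat.eqb (partner M v) (S v) then 1 else 0)%nat
  end.

Definition grid (i : nat) : R := INR i / INR (cell (size M)).
Definition mL (v : nat) : R := grid (cell v).
Definition mQ (v : nat) : R := grid (cell v + 1).

Lemma cell_lt v w : (v < w)%nat -> (cell v < cell w)%nat.
Proof. induction 1; simpl; lia. Qed.

Lemma cells_pos : 0 < INR (cell (size M)).
Proof. apply lt_0_INR. pose proof (cell_lt 0 (size M) hsize). simpl in *. lia. Qed.

Lemma grid_lt i j : (i < j)%nat <-> grid i < grid j.
Proof.
  pose proof (Rinv_0_lt_compat _ cells_pos). unfold grid, Rdiv. split; intros h.
  - apply Rmult_lt_compat_r; auto. apply lt_INR; auto.
  - apply Rmult_lt_reg_r in h; auto. apply INR_lt; auto.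
Qed.

Lemma grid_le i j : (i <= j)%nat <-> grid i <= grid j.
Proof.
  split; intros h.
  - apply Rnot_lt_le. intro c. apply grid_lt in c. lia.
  - apply Nat.nlt_ge. intro c. apply grid_lt in c. lra.
Qed.

Lemma grid_add i j : grid (i + j) = grid i + INR j * grid 1.
Proof.
  pose proof cells_pos. unfold grid. rewrite plus_INR. change (INR 1) with 1. field. lra.
Qed.

Lemma grid_top : grid (cell (size M)) = 1.
Proof. pose proof cells_pos. unfold grid. field. lra. Qed.

Lemma grid_0 : grid 0 = 0.
Proof. unfold grid. simpl. unfold Rdiv. ring. Qed.

Lemma cell_succ_le v w : (v < w)%nat -> (cell v + 1 <= cell w)%nat.
Proof. intros h. pose proof (cell_lt v w h). lia. Qed.

(** Source of the constant 2: if the feet are adjacent the extra cell separates them, and otherwise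
    another foot does. *)
Lemma cell_partner v : opening M v -> (cell v + 2 <= cell (partner M v))%nat.
Proof.
  intros [h1 h2]. destruct (Nat.eq_dec (partner M v) (S v)) as [e|e].
  - rewrite e at 1. simpl. rewrite e, Nat.eqb_refl. lia.
  - pose proof (cell_lt (S v) (partner M v) ltac:(lia)). pose proof (cell_lt v (S v) ltac:(lia)). lia.
Qed.

Lemma mL_lt_mQ v : mL v < mQ v.
Proof. apply grid_lt. lia. Qed.

Lemma mQ_le_mL v w : (v < w)%nat -> mQ v <= mL w.
Proof. intros h. apply grid_le. apply cell_succ_le; auto. Qed.

Lemma mL_ge v : 0 <= mL v.
Proof. rewrite <- grid_0. apply grid_le. lia. Qed.

Lemma mQ_le v : (v < size M)%nat -> mQ v <= 1.
Proof. intros h. rewrite <- grid_top. apply grid_le. apply cell_succ_le; auto. Qed.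

Lemma model_order v : opening M v ->
  mL v < mQ v /\ mQ v < mL (partner M v) /\ mL (partner M v) < mQ (partner M v).
Proof.
  intros hv. pose proof (cell_partner v hv). repeat split; apply grid_lt; lia.
Qed.

Definition mE (v : nat) : R -> R :=
  let w := partner M v in
  if Nat.ltb v w then kink (mL v) (mQ v) (mQ w) (mL w) else kink (mL w) (mL v) (mQ v) (mQ w).

Lemma mE_opening v : opening M v ->
  mE v = kink (mL v) (mQ v) (mQ (partner M v)) (mL (partner M v)).
Proof.
  intros [h1 h2]. unfold mE. apply Nat.ltb_lt in h2. rewrite h2. auto.
Qed.

Lemma mE_partner v : opening M v ->
  mE (partner M v) = kink (mL v) (mL (partner M v)) (mQ (partner M v)) (mQ v).
Proof.
  intros [h1 h2]. unfold mE. rewrite (partnerK M hM v h1).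
  destruct (Nat.ltb_spec (partner M v) v); [lia|auto].
Qed.

Definition on_orbital (lam : nat) (t : R) (v : nat) : Prop :=
  opening M v /\ label M v = lam /\ mL v < t < mQ (partner M v).

(** By [hsep] at most one orbital with this label contains t, so the choice of v is forced. *)
Definition mF (lam : nat) (t : R) : R :=
  if excluded_middle_informative (exists v, on_orbital lam t v) then
    let v := epsilon (inhabits O) (on_orbital lam t) in
    if rising M v then mE v t else mE (partner M v) t
  else t.

(** The orbital of v is taken closed so that [mF_on] also covers its ends. *)
Lemma orbital_unique v w t : opening M v -> opening M w -> label M v = label M w ->
  mL v <= t <= mQ (partner M v) -> mL w < t < mQ (partner M w) -> v = w.
Proof.
  intros hv hw e h1 h2. destruct (lt_eq_lt_dec v w) as [[h|h]|h]; auto; exfalso.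
  - apply hsep in h; auto. apply mQ_le_mL in h. lra.
  - apply hsep in h; auto. apply mQ_le_mL in h. lra.
Qed.

Lemma mE_fix v t : opening M v -> ~ (mL v < t < mQ (partner M v)) ->
  mE v t = t /\ mE (partner M v) t = t.
Proof.
  intros hv ht. pose proof (model_order v hv). rewrite mE_opening, mE_partner by auto.
  split; apply kink_off; auto; lra.
Qed.

Lemma mF_off lam t : (forall v, opening M v -> label M v = lam -> ~ (mL v < t < mQ (partner M v))) ->
  mF lam t = t.
Proof.
  intros h. unfold mF. destruct (excluded_middle_informative _) as [[v [h1 [h2 h3]]]|]; auto.
  exfalso. apply (h v); auto.
Qed.

Lemma mF_on v t : opening M v -> mL v <= t <= mQ (partner M v) ->
  mF (label M v) t = (if rising M v then mE v t else mE (partner M v) t).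
Proof.
  intros hv ht. unfold mF. destruct (excluded_middle_informative _) as [ex|no].
  - pose proof (epsilon_spec (inhabits O) _ ex) as [h1 [h2 h3]].
    set (w := epsilon _ _) in *. cbv zeta.
    rewrite <- (orbital_unique v w t); auto.
  - destruct (mE_fix v t hv) as [e1 e2].
    + intro c. apply no. exists v. split; auto.
    + rewrite e1, e2. destruct (rising M v); auto.
Qed.

Lemma mE_line_homeo v : (v < size M)%nat -> line_homeo (mE v).
Proof.
  intros hv. destruct (opening_cases M v hM hv) as [ho|ho].
  - pose proof (model_order v ho). rewrite mE_opening by auto.
    apply kink_line_homeo; try lra; [apply mL_ge|apply mQ_le; apply opening_partner_lt; auto].
  - pose proof (model_order _ ho) as h. pose proof (mE_partner _ ho) as e.
    rewrite (partnerK M hM v hv) in *. rewrite e.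
    apply kink_line_homeo; try lra; [apply mL_ge|apply mQ_le; auto].
Qed.

Lemma mE_cancel v t : (v < size M)%nat -> mE (partner M v) (mE v t) = t.
Proof.
  intros hv. destruct (opening_cases M v hM hv) as [ho|ho].
  - pose proof (model_order v ho). rewrite (mE_opening v), (mE_partner v) by auto. apply kinkK; lra.
  - pose proof (model_order _ ho) as h. pose proof (mE_partner _ ho) as e.
    pose proof (mE_opening _ ho) as e'.
    rewrite (partnerK M hM v hv) in *. rewrite e, e'. apply kinkK; lra.
Qed.

(* [act v] is the vertex whose expanding map is the restriction of the generator to the orbital. *)
Definition act (v : nat) : nat := if rising M v then v else partner M v.

Lemma mF_act v t : opening M v -> mL v <= t <= mQ (partner M v) -> mF (label M v) t = mE (act v) t.
Proof. intros hv ht. rewrite mF_on by auto. unfold act. destruct (rising M v); auto. Qed.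

Lemma act_lt v : opening M v -> (act v < size M)%nat.
Proof.
  intros hv. unfold act. destruct (rising M v); [exact (proj1 hv)|apply opening_partner_lt; auto].
Qed.

Lemma mE_orbital v u t : opening M v -> u = v \/ u = partner M v ->
  mL v < t < mQ (partner M v) -> mL v < mE u t < mQ (partner M v).
Proof.
  intros hv hu [a b].
  assert (hl : (u < size M)%nat).
  { destruct hu as [-> | ->]; [exact (proj1 hv)|apply opening_partner_lt; auto]. }
  pose proof (proj1 (mE_line_homeo u hl)) as hi. apply hi in a, b.
  destruct (mE_fix v (mL v) hv ltac:(lra)) as [e1 e2].
  destruct (mE_fix v (mQ (partner M v)) hv ltac:(lra)) as [e3 e4].
  destruct hu; subst u; [rewrite e1 in a; rewrite e3 in b|rewrite e2 in a; rewrite e4 in b]; auto.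
Qed.

Lemma act_cases v : act v = v \/ act v = partner M v.
Proof. unfold act. destruct (rising M v); auto. Qed.

(** Orbitals with one label are disjoint and each is mapped onto itself by an increasing map; what
    remains is to compare points in different orbitals or off them. *)
Lemma mF_line_homeo lam : line_homeo (mF lam).
Proof.
  assert (hcase : forall t, (exists v, on_orbital lam t v) \/ mF lam t = t).
  { intros t. destruct (classic (exists v, on_orbital lam t v)) as [h|h]; auto.
    right. apply mF_off. intros v h1 h2 h3. apply h. exists v. split; auto. }
  assert (horb : forall t v, on_orbital lam t v -> mL v < mF lam t < mQ (partner M v)).
  { intros t v [h1 [<- h3]]. rewrite mF_act by (auto; lra).
    apply mE_orbital; auto. apply act_cases. }
  split; [|split].
  - intros s t hst.
    destruct (hcase s) as [[v hv]|es]; destruct (hcase t) as [[w hw]|et].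
    + destruct (Nat.eq_dec v w) as [<-|ne].
      * destruct hv as [h1 [<- h3]]. destruct hw as [_ [_ h4]].
        rewrite !mF_act by (auto; lra). apply (proj1 (mE_line_homeo _ (act_lt v h1))); auto.
      * pose proof (horb s v hv). pose proof (horb t w hw).
        destruct hv as [h1 [h2 h3]]. destruct hw as [h4 [h5 h6]].
        destruct (lt_eq_lt_dec v w) as [[h|h]|h]; [|lia|];
        apply hsep in h; auto; try congruence; apply mQ_le_mL in h; lra.
    + pose proof (horb s v hv). destruct hv as [h1 [h2 h3]]. rewrite et.
      (* A fixed t cannot lie in the orbital of s, where every point moves, so it lies beyond its
         right end. *)
      destruct (Rlt_le_dec t (mQ (partner M v))) as [h|h]; [|lra].
      exfalso. assert (hh : mL v < t < mQ (partner M v)) by lra.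
      subst lam. rewrite mF_on in et by (auto; lra). rewrite mE_opening, mE_partner in et by auto.
      pose proof (model_order v h1).
      pose proof (kink_pos (mL v) (mQ v) (mQ (partner M v)) (mL (partner M v)) t
        ltac:(lra) ltac:(lra) hh) as hp.
      destruct (rising M v); [lra|].
      pose proof (kinkK (mL v) (mL (partner M v)) (mQ (partner M v)) (mQ v) t ltac:(lra) ltac:(lra)) as hk.
      rewrite et in hk. lra.
    + pose proof (horb t w hw). destruct hw as [h1 [h2 h3]]. rewrite es.
      destruct (Rle_lt_dec s (mL w)) as [h|h]; [lra|].
      assert (hs : on_orbital lam s w) by (split; auto; split; auto; lra).
      rewrite <- es. subst lam. rewrite !mF_act by (auto; lra).
      apply (proj1 (mE_line_homeo _ (act_lt w h1))); auto.
    + lra.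
  - intros t. destruct (hcase t) as [[v hv]|et]; [|eauto].
    destruct hv as [h1 [<- h3]].
    pose proof (opening_partner_lt M v hM h1) as hp.
    set (u := act v). pose proof (act_lt v h1) as hu.
    exists (mE (partner M u) t). rewrite mF_act; auto.
    + fold u. pose proof (mE_cancel (partner M u) t (partner_lt M hM u hu)) as hc.
      rewrite (partnerK M hM u hu) in hc. exact hc.
    + assert (mL v < mE (partner M u) t < mQ (partner M v)); [|lra].
      apply mE_orbital; auto. unfold u. destruct (act_cases v) as [-> | ->]; auto.
      left. apply (partnerK M hM). exact (proj1 h1).
  - intros t ht. apply mF_off. intros v h1 h2 h3. apply ht.
    pose proof (mL_ge v). pose proof (mQ_le _ (opening_partner_lt M v hM h1)). lra.
Qed.

Lemma model_realizes : realizes M mL mQ mE mF.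
Proof.
  constructor.
  - intros. apply mL_lt_mQ.
  - intros. apply mQ_le_mL; auto.
  - intros. apply mL_ge.
  - intros. apply mQ_le; auto.
  - apply mE_line_homeo.
  - intros. apply mE_cancel; auto.
  - intros v hv. pose proof (model_order v hv). rewrite mE_opening by auto. apply kink_mid. lra.
  - intros v t hv ht. apply mE_fix; auto.
  - intros v t hv ht. pose proof (model_order v hv). rewrite mE_opening by auto.
    apply kink_pos; auto; lra.
  - intros. apply mF_line_homeo.
  - intros. apply mF_on; auto.
  - apply mF_off.
Qed.

(** The break point is a grid point, so no grid interval straddles it. *)
Lemma kink_affine_on_cell x m y m' c i : x < m < y -> m = grid c -> x <= grid i -> grid (S i) <= y ->
  exists a b, forall t, grid i <= t <= grid (S i) -> kink x m y m' t = a * t + b.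
Proof.
  intros h -> hx hy. destruct (le_lt_dec (S i) c) as [hc|hc].
  - apply grid_le in hc. exists ((m' - x) / (grid c - x)), (x - x * ((m' - x) / (grid c - x))).
    intros t ht. rewrite kink_left by lra. ring.
  - assert (hc' : (c <= i)%nat) by lia. apply grid_le in hc'.
    exists ((y - m') / (y - grid c)), (y - y * ((y - m') / (y - grid c))).
    intros t ht. rewrite kink_right by lra. ring.
Qed.

Lemma mF_PL lam : PL_homeo (mF lam).
Proof.
  split; [apply line_homeo_homeo, mF_line_homeo|].
  exists (cell (size M)), grid. split; [apply grid_0|]. split; [apply grid_top|].
  split; [intros; apply grid_lt; lia|]. intros i hi.
  (* Grid interval i lies in the orbital of v exactly for these i: the right foot is the single cell
     starting at [cell (partner M v)]. *)
  destruct (classic (exists v, opening M v /\ label M v = lam /\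
    (cell v <= i)%nat /\ (i <= cell (partner M v))%nat)) as [[v [hv [<- [h1 h2]]]]|no].
  - pose proof (model_order v hv).
    assert (hx : mL v <= grid i) by (apply grid_le; auto).
    assert (hy : grid (S i) <= mQ (partner M v)) by (apply grid_le; lia).
    assert (hF : forall t, grid i <= t <= grid (S i) ->
      mF (label M v) t = (if rising M v then mE v t else mE (partner M v) t))
      by (intros; apply mF_on; auto; lra).
    rewrite mE_opening, mE_partner in hF by auto.
    destruct (rising M v).
    + destruct (kink_affine_on_cell (mL v) (mQ v) (mQ (partner M v)) (mL (partner M v))
        (cell v + 1) i) as [a [b hab]]; auto; [lra|].
      exists a, b. intros t ht. rewrite hF, hab; auto.
    + destruct (kink_affine_on_cell (mL v) (mL (partner M v)) (mQ (partner M v)) (mQ v)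
        (cell (partner M v)) i) as [a [b hab]]; auto; [lra|].
      exists a, b. intros t ht. rewrite hF, hab; auto.
  - exists 1, 0. intros t ht. rewrite mF_off; [ring|].
    intros v hv e htv. apply no. exists v. split; auto. split; auto.
    assert (a : grid (cell v) < grid (S i)) by (unfold mL in htv; lra).
    assert (b : grid i < grid (cell (partner M v) + 1)) by (unfold mQ in htv; lra).
    apply grid_lt in a, b. lia.
Qed.

(** * Affine branches of the model and their inverse contractions *)

(** The end of the foot fixed by its expanding map. *)
Definition anchor (v : nat) : R := if Nat.ltb v (partner M v) then mL v else mQ v.

Definition slope (v : nat) : R :=
  let w := partner M v in
  if Nat.ltb v w then (mL w - mL v) / (mQ v - mL v) else (mQ v - mQ w) / (mQ v - mL v).

(** The affine branch of [mE v] extended to the whole line, so that the distance estimates hold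
    without domain conditions. *)
Definition expand (v : nat) (x : R) : R := anchor v + (x - anchor v) * slope v.
Definition contract (v : nat) (x : R) : R := anchor v + (x - anchor v) / slope v.

Lemma cell_width v : mQ v - mL v = grid 1.
Proof. unfold mQ, mL. rewrite grid_add. simpl. ring. Qed.

Lemma grid_1_pos : 0 < grid 1.
Proof. rewrite <- grid_0. apply grid_lt. lia. Qed.

Lemma cell_partner_dist v : opening M v -> 2 * grid 1 <= mL (partner M v) - mL v.
Proof.
  intros hv. pose proof (cell_partner v hv) as h. apply grid_le in h.
  rewrite grid_add in h. simpl INR in h. unfold mL. lra.
Qed.

Lemma slope_ge v : (v < size M)%nat -> 2 <= slope v.
Proof.
  intros hv. pose proof grid_1_pos.
  assert (h : forall a, 2 * grid 1 <= a -> 2 <= a / grid 1).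
  { intros a ha. apply Rmult_le_reg_r with (grid 1); auto. unfold Rdiv.
    rewrite Rmult_assoc, Rinv_l; lra. }
  unfold slope. rewrite cell_width. destruct (opening_cases M v hM hv) as [ho|ho].
  - destruct (Nat.ltb_spec v (partner M v)); [|destruct ho; lia].
    apply h. apply cell_partner_dist; auto.
  (* The slope of a right foot compares right ends; as all feet are equally wide, their distance is
     that of the left ends. *)
  - pose proof (cell_partner_dist _ ho) as hd. rewrite (partnerK M hM v hv) in hd.
    pose proof (cell_width v). pose proof (cell_width (partner M v)).
    destruct (Nat.ltb_spec v (partner M v)); apply h; [|lra].
    destruct ho as [_ ho]. rewrite (partnerK M hM v hv) in ho. lia.
Qed.

Lemma expand_contract v x : (v < size M)%nat -> expand v (contract v x) = x.
Proof.
  intros hv. pose proof (slope_ge v hv). unfold expand, contract. field. lra.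
Qed.

Lemma expand_dist v x y : (v < size M)%nat -> 2 * Rabs (x - y) <= Rabs (expand v x - expand v y).
Proof.
  intros hv. pose proof (slope_ge v hv). unfold expand.
  replace (anchor v + (x - anchor v) * slope v - (anchor v + (y - anchor v) * slope v))
    with ((x - y) * slope v) by ring.
  rewrite Rabs_mult, (Rabs_right (slope v)) by lra. pose proof (Rabs_pos (x - y)). nra.
Qed.

Lemma contract_dist v x y : (v < size M)%nat -> Rabs (contract v x - contract v y) <= Rabs (x - y) / 2.
Proof.
  intros hv. pose proof (expand_dist v (contract v x) (contract v y) hv) as h.
  rewrite !expand_contract in h by auto. lra.
Qed.

Lemma contract_increasing v : (v < size M)%nat -> increasing (contract v).
Proof.
  intros hv x y hxy. pose proof (slope_ge v hv). unfold contract.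
  pose proof (Rinv_0_lt_compat (slope v) ltac:(lra)). unfold Rdiv. nra.
Qed.

Lemma contract_continuity v : continuity (contract v).
Proof. apply derivable_continuous. intros t. unfold contract, Rdiv. reg. Qed.

Lemma mE_expand v t : (v < size M)%nat -> mL v <= t <= mQ v -> mE v t = expand v t.
Proof.
  intros hv ht. pose proof (mL_lt_mQ v). unfold mE, expand, anchor, slope.
  destruct (opening_cases M v hM hv) as [ho|ho].
  - destruct (Nat.ltb_spec v (partner M v)); [|destruct ho; lia].
    rewrite kink_left; auto.
  - pose proof (model_order _ ho) as h. rewrite (partnerK M hM v hv) in h.
    destruct ho as [_ ho]. rewrite (partnerK M hM v hv) in ho.
    destruct (Nat.ltb_spec v (partner M v)); [lia|]. rewrite kink_right by lra. auto.
Qed.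

Lemma contract_mE v t : (v < size M)%nat -> mL v <= t <= mQ v -> contract v (mE v t) = t.
Proof.
  intros hv ht. pose proof (slope_ge v hv). rewrite mE_expand by auto.
  unfold expand, contract. field. lra.
Qed.

Lemma contract_ends v : opening M v ->
  contract v (mL v) = mL v /\ contract v (mL (partner M v)) = mQ v /\
  contract (partner M v) (mQ v) = mL (partner M v) /\
  contract (partner M v) (mQ (partner M v)) = mQ (partner M v).
Proof.
  intros hv. pose proof (opening_partner_lt M v hM hv) as hp. pose proof (proj1 hv) as hv1.
  pose proof (model_order v hv). pose proof model_realizes as hR.
  split; [|split; [|split]].
  - rewrite <- (E_l M mL mQ mE mF hR v hv) at 1. apply contract_mE; auto; lra.
  - rewrite <- (E_mid _ _ _ _ _ hR v hv). apply contract_mE; auto; lra.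
  - rewrite <- (E_partner_l M mL mQ mE mF hR v hv). apply contract_mE; auto; lra.
  - rewrite <- (E_partner_off M mL mQ mE mF hR v (mQ (partner M v)) hv) at 1; [|lra].
    apply contract_mE; auto; lra.
Qed.

Lemma model_gap v : (v < size M)%nat -> mQ v < mL (S v) -> partner M v = S v.
Proof.
  intros hv h. apply grid_lt in h. simpl in h.
  destruct (Nat.eqb_spec (partner M v) (S v)); auto. lia.
Qed.

Lemma semiconjugacy_to_model l r E F : realizes M l r E F ->
  exists th, continuity th /\ increasing th /\ (forall t, 0 <= th t <= 1) /\
    (forall v, (v < size M)%nat -> th (l v) = mL v /\ th (r v) = mQ v) /\
    (forall v t, (v < size M)%nat -> l v <= t <= r v -> th (E v t) = expand v (th t)) /\
    (forall lam t, th (F lam t) = mF lam (th t)).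
Proof.
  intros hR.
  destruct (semiconjugacy_exists M hM l r E F hR mL mQ contract) as [th [[h1 [h2 h3]] [h4 h5]]].
  - apply grid_0.
  - apply grid_top.
  - intros; apply mL_lt_mQ.
  - intros; apply mQ_le_mL; lia.
  - apply model_gap.
  - intros; apply contract_continuity.
  - apply contract_increasing.
  - apply contract_dist.
  - intros v hv. apply (contract_ends v hv).
  - intros v hv. apply (contract_ends v hv).
  - intros v hv. apply (contract_ends v hv).
  - intros v hv. apply (contract_ends v hv).
  - assert (h6 : forall v t, (v < size M)%nat -> l v <= t <= r v -> th (E v t) = expand v (th t)).
    { intros v t hv ht. rewrite (h5 v t hv ht). symmetry. apply expand_contract; auto. }
    exists th. repeat (split; [assumption|]).
    intros lam t. apply (intertwine_F M hM l r E F hR mL mQ mE mF model_realizes); auto.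
    + intros v hv. apply h3; auto.
    + intros v hv. apply h3; auto.
    + intros v s hv hs. rewrite h6 by auto. symmetry. apply mE_expand; auto.
      destruct (h3 v hv) as [<- <-]. split; apply h2; lra.
Qed.

End Model.

(** * The matching of a diagram *)

Definition touches (v : nat) (e : nat * nat * nat) : bool :=
  Nat.eqb (fst (fst e)) v || Nat.eqb (snd (fst e)) v.

(** Total degree 1 makes the edge found at a vertex the only one there; the [None] branches are
    defaults outside the vertex range. *)
Definition matching_of (D : diagram) : matching :=
  let edge_at v := find (touches v) (dg_edges D) in
  Matching (dg_n D)
    (fun v => match edge_at v with Some (u, w, _) => if Nat.eqb u v then w else u | None => v end)
    (fun v => match edge_at v with Some (_, _, k) => k | None => O end)
    (fun v => match edge_at v with Some (u, w, _) => Nat.ltb u w | None => true end).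

Section Diagram.

Context (D : diagram) (hD : is_diagram D).

Let M := matching_of D.

(** Degree 1 in the abstract, with f and g testing source and target: one filtered list is a
    singleton, the other is empty. The conclusions give an edge, exclude loops and make the edge
    unique. *)
Lemma filter_sum_one {A} (f g : A -> bool) s : (length (filter f s) + length (filter g s) = 1)%nat ->
  (exists e, In e s /\ (f e || g e)%bool = true) /\
  (forall e, In e s -> (f e && g e)%bool = false) /\
  (forall e e', In e s -> In e' s -> (f e || g e)%bool = true -> (f e' || g e')%bool = true -> e = e').
Proof.
  intros h.
  assert (hf : forall e, In e (filter f s) <-> In e s /\ f e = true) by (intros; apply filter_In).
  assert (hg : forall e, In e (filter g s) <-> In e s /\ g e = true) by (intros; apply filter_In).
  destruct (filter f s) as [|x [|]] eqn:ef; destruct (filter g s) as [|y [|]] eqn:eg; simpl in h; try lia.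
  - simpl in hf, hg. split; [|split].
    + exists y. destruct (proj1 (hg y)) as [a b]; auto. rewrite b, orb_true_r. auto.
    + intros e he. destruct (f e) eqn:e1; auto. exfalso. apply (hf e). auto.
    + intros e e' h1 h2 h3 h4.
      destruct (f e) eqn:e1; [exfalso; apply (hf e); auto|].
      destruct (f e') eqn:e2; [exfalso; apply (hf e'); auto|].
      simpl in h3, h4. destruct (proj2 (hg e)) as [<-|[]]; auto.
      destruct (proj2 (hg e')) as [<-|[]]; auto.
  - simpl in hf, hg. split; [|split].
    + exists x. destruct (proj1 (hf x)) as [a b]; auto. rewrite b. auto.
    + intros e he. destruct (g e) eqn:e1; [exfalso; apply (hg e); auto|]. apply andb_false_r.
    + intros e e' h1 h2 h3 h4.
      destruct (g e) eqn:e1; [exfalso; apply (hg e); auto|].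
      destruct (g e') eqn:e2; [exfalso; apply (hg e'); auto|].
      rewrite orb_false_r in h3, h4. destruct (proj2 (hf e)) as [<-|[]]; auto.
      destruct (proj2 (hf e')) as [<-|[]]; auto.
Qed.

Lemma edge_at_unique v e : (v < dg_n D)%nat -> In e (dg_edges D) -> touches v e = true ->
  find (touches v) (dg_edges D) = Some e.
Proof.
  intros hv he ht. destruct (find (touches v) (dg_edges D)) as [e'|] eqn:ef.
  - apply find_some in ef. destruct ef as [h1 h2]. f_equal.
    apply (filter_sum_one _ _ _ (proj2 hD v hv)); auto.
  - pose proof (find_none _ _ ef e he). congruence.
Qed.

Lemma edge_data u w k : In (u, w, k) (dg_edges D) ->
  (u < size M)%nat /\ (w < size M)%nat /\ u <> w /\ partner M u = w /\ partner M w = u /\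
  label M u = k /\ label M w = k /\ rising M u = Nat.ltb u w /\ rising M w = Nat.ltb u w.
Proof.
  intros he. destruct (proj1 hD u w k he) as [hu hw].
  assert (hne : u <> w).
  { intros <-. pose proof (filter_sum_one _ _ _ (proj2 hD u hu)) as [_ [h _]].
    specialize (h _ he). simpl in h. rewrite Nat.eqb_refl in h. discriminate. }
  assert (eu : find (touches u) (dg_edges D) = Some (u, w, k)).
  { apply edge_at_unique; auto. unfold touches. simpl. rewrite Nat.eqb_refl. auto. }
  assert (ew : find (touches w) (dg_edges D) = Some (u, w, k)).
  { apply edge_at_unique; auto. unfold touches. simpl. rewrite Nat.eqb_refl, orb_true_r. auto. }
  simpl. rewrite eu, ew, Nat.eqb_refl. destruct (Nat.eqb_spec u w); [contradiction|].
  repeat split; auto.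
Qed.

Lemma edge_at_exists v : (v < size M)%nat ->
  exists u w k, In (u, w, k) (dg_edges D) /\ (v = u \/ v = w).
Proof.
  intros hv. destruct (filter_sum_one _ _ _ (proj2 hD v hv)) as [[[[u w] k] [h1 h2]] _].
  exists u, w, k. split; auto. simpl in h2. apply orb_true_iff in h2.
  destruct h2 as [h|h]; apply Nat.eqb_eq in h; auto.
Qed.

Lemma matching_of_is_matching : is_matching M.
Proof.
  constructor; intros v hv; destruct (edge_at_exists v hv) as [u [w [k [he hvuw]]]];
  destruct (edge_data u w k he) as [h1 [h2 [h3 [h4 [h5 [h6 [h7 [h8 h9]]]]]]]];
  destruct hvuw; subst v; congruence.
Qed.

End Diagram.

(** * The realization given by a set of homeomorphisms *)

Lemma first_fixed_point g t :
  line_homeo g -> g t <> t ->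
  exists d, t < d /\ g d = d /\ forall s, t <= s < d -> g s <> s.
Proof.
  intros [h1 [h2 h3]] ht.
  (* Conjugation by the reflection s -> 1 - s exchanges first and last. *)
  destruct (last_fixed_point (fun s => 1 - g (1 - s)) (1 - t)) as [c [hc1 [hc2 hc3]]].
  - split; [|split].
    + intros a b hab. assert (g (1 - b) < g (1 - a)) by (apply h1; lra). lra.
    + intros a. destruct (h2 (1 - a)) as [s hs]. exists (1 - s).
      replace (1 - (1 - s)) with s by ring. lra.
    + intros a ha. rewrite h3 by lra. ring.
  - replace (1 - (1 - t)) with t by ring. lra.
  - exists (1 - c). split; [lra|]. split; [lra|]. intros s hs e.
    apply (hc3 (1 - s)); [lra|]. replace (1 - (1 - s)) with s by ring. lra.
Qed.

(** The bump is f cut down to its orbital (c, d) around t; since f fixes c and d, extending by the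
    identity stays increasing and onto. *)
Lemma bump_through f t : line_homeo f -> f t <> t ->
  exists b, signed_bump_of b f /\ supt b t.
Proof.
  intros hf ht.
  destruct (last_fixed_point f t hf ht) as [c [hc1 [hc2 hc3]]].
  destruct (first_fixed_point f t hf ht) as [d [hd1 [hd2 hd3]]].
  pose proof hf as [h1 [h2 h3]].
  set (b := fun s => if excluded_middle_informative (c < s < d) then f s else s).
  assert (hin : forall s, c < s < d -> b s = f s /\ f s <> s /\ c < f s < d).
  { intros s hs. unfold b. destruct (excluded_middle_informative _); [|tauto].
    split; auto. split.
    - destruct (Rle_lt_dec s t); [apply hc3|apply hd3]; lra.
    - assert (f c < f s < f d) by (split; apply h1; lra). lra. }
  assert (hout : forall s, ~ (c < s < d) -> b s = s).
  { intros s hs. unfold b. destruct (excluded_middle_informative _); tauto. }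
  assert (hs : forall s, supt b s <-> c < s < d).
  { intros s. unfold supt. split; intros h.
    - apply NNPP. intro h'. apply h. apply hout; auto.
    - destruct (hin s h) as [-> [? _]]. auto. }
  assert (hb : line_homeo b).
  { split; [|split].
    - intros u v huv. destruct (classic (c < u < d)) as [a|a]; destruct (classic (c < v < d)) as [a'|a'].
      + destruct (hin u a) as [-> _]. destruct (hin v a') as [-> _]. auto.
      + destruct (hin u a) as [-> [_ ?]]. rewrite (hout v a'). lra.
      + destruct (hin v a') as [-> [_ ?]]. rewrite (hout u a). lra.
      + rewrite (hout u a), (hout v a'). auto.
    - intros v. destruct (classic (c < v < d)) as [a|a]; [|exists v; apply hout; auto].
      destruct (h2 v) as [u hu]. exists u.
      assert (c < u < d).
      { split; apply (strict_increasing_lt_inv f h1); lra. }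
      destruct (hin u H) as [-> _]. auto.
    - intros s hs'. destruct (classic (c < s < d)) as [a|a]; [|apply hout; auto].
      destruct (hin s a) as [-> _]. auto. }
  exists b. split; [split|].
  - split; [apply line_homeo_homeo; auto|]. exists c, d. split; [lra|auto].
  - intros s h. apply hs in h. destruct (hin s h) as [-> _]. auto.
  - apply hs. lra.
Qed.

Lemma bump_line_homeo a : bump a -> line_homeo a.
Proof. intros [h _]. apply homeo_line_homeo; auto. Qed.

Lemma inv_fixes a t : line_homeo a -> (inv a t = t <-> a t = t).
Proof.
  intros h. split; intros e.
  - rewrite <- e at 1. apply inv_right. exact (proj1 (proj2 h)).
  - apply inv_eq; auto.
Qed.

Lemma supt_inv a t : line_homeo a -> (supt (inv a) t <-> supt a t).
Proof. intros h. unfold supt. rewrite inv_fixes; tauto. Qed.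

Lemma bump_inv a : bump a -> bump (inv a).
Proof.
  intros h. pose proof (bump_line_homeo a h) as hl. destruct h as [h [x [y [hxy hs]]]]. split.
  - apply line_homeo_homeo, line_homeo_inv; auto.
  - exists x, y. split; auto. intros t. rewrite supt_inv; auto.
Qed.

Lemma inv_neg a t : pos_bump a -> supt a t -> inv a t < t.
Proof.
  intros [hb hp] ht. pose proof (bump_line_homeo a hb) as hl.
  apply (strict_increasing_lt_inv a (proj1 hl)). rewrite inv_right by exact (proj1 (proj2 hl)).
  apply hp; auto.
Qed.

Lemma pos_bump_inv_not_positive a : pos_bump a -> ~ positive (inv a).
Proof.
  intros ha hp. pose proof ha as [hb _]. pose proof (bump_line_homeo a hb) as hl.
  destruct hb as [_ [x [y [hxy hs]]]].
  assert (h : supt a ((x + y) / 2)) by (apply hs; lra).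
  pose proof (inv_neg a _ ha h). apply supt_inv in h; auto. apply hp in h. lra.
Qed.

(** A failure of positivity gives a single point moved down. A bump cannot also move a point up, for
    then it would fix a point between the two, inside its orbital. *)
Lemma bump_not_positive_inv b : bump b -> ~ positive b -> pos_bump (inv b).
Proof.
  intros hb hn. pose proof (bump_line_homeo b hb) as hl. split; [apply bump_inv; auto|].
  intros t ht. rewrite supt_inv in ht by auto.
  apply (strict_increasing_lt_inv b (proj1 hl)). rewrite inv_right by exact (proj1 (proj2 hl)).
  assert (exists s, supt b s /\ b s < s) as [s [hs1 hs2]].
  { apply NNPP. intro no. apply hn. intros s hs. apply Rnot_le_gt. intro c. apply no.
    exists s. split; auto. destruct c; auto. contradiction. }
  destruct (Rtotal_order (b t) t) as [h|[h|h]]; auto; [elim (ht h)|]. exfalso.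
  destruct hb as [_ [x [y [hxy hs]]]].
  (* The factor sg lets the intermediate value lemma, stated for f a <= f b, serve both orders of s
     and t. *)
  assert (hc : forall sg, continuity (fun u => sg * (b u - u))).
  { intros sg. apply (continuity_mult (fun _ => sg) (fun u => b u - u)).
    - apply continuity_const. intros ? ?; auto.
    - apply (continuity_minus b (fun u => u)); [apply line_homeo_continuity; auto|].
      apply derivable_continuous, derivable_id. }
  apply hs in ht as ht'. apply hs in hs1 as hs1'.
  destruct (Rle_lt_dec s t) as [hst|hst].
  - destruct (intermediate_value _ s t 0 (hc 1) hst) as [z [hz1 hz2]]; [lra|].
    apply (proj2 (hs z)); lra.
  - destruct (intermediate_value _ t s 0 (hc (-1)) ltac:(lra)) as [z [hz1 hz2]]; [lra|].
    apply (proj2 (hs z)); lra.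
Qed.

Definition left_end (a : R -> R) : R :=
  epsilon (inhabits 0) (fun x => exists y, x < y /\ forall t, supt a t <-> x < t < y).
Definition right_end (a : R -> R) : R :=
  epsilon (inhabits 0) (fun y => left_end a < y /\ forall t, supt a t <-> left_end a < t < y).

Lemma supt_ends a : bump a -> forall t, supt a t <-> left_end a < t < right_end a.
Proof.
  intros [_ h].
  assert (h1 : exists y, left_end a < y /\ forall t, supt a t <-> left_end a < t < y).
  { unfold left_end. apply epsilon_spec with (P := fun x => exists y, x < y /\ forall t, supt a t <-> x < t < y).
    exact h. }
  assert (h2 : left_end a < right_end a /\ forall t, supt a t <-> left_end a < t < right_end a).
  { unfold right_end. apply epsilon_spec. exact h1. }
  apply h2.
Qed.

(** If the intervals met or were reversed, a point of A could be chosen to the right of a point of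
    B. Open intervals suffice, which fits source feet lacking their left end. *)
Lemma interval_before (A B : R -> Prop) x y x' y' : x < y -> x' < y' ->
  (forall t, x < t < y -> A t) -> (forall t, x' < t < y' -> B t) -> foot_before A B -> y <= x'.
Proof.
  intros h h' hA hB hAB. apply Rnot_lt_le. intro c.
  set (u := (Rmax x x' + y) / 2).
  pose proof (Rmax_l x x'). pose proof (Rmax_r x x').
  assert (Rmax x x' < y) by (apply Rmax_lub_lt; auto).
  set (u' := (x' + Rmin y' u) / 2).
  pose proof (Rmin_l y' u). pose proof (Rmin_r y' u).
  assert (x' < Rmin y' u) by (apply Rmin_glb_lt; unfold u; lra).
  assert (u < u'); [|unfold u', u in *; lra].
  apply hAB; [apply hA|apply hB]; unfold u', u in *; lra.
Qed.

Section FromDiagram.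

Context (D : diagram) (hD : is_diagram D) (X : (R -> R) -> Prop) (hX : forall f, X f -> homeo f).

Let M := matching_of D.

Context (m : (R -> R) -> R) (hm : good_marking (used X) m)
  (vtx : (R -> R) -> bool -> nat) (lab : (R -> R) -> nat)
  (Hlt : forall a s, used X a -> (vtx a s < dg_n D)%nat)
  (Hinj : forall a s a' s', used X a -> used X a' -> vtx a s = vtx a' s' -> a = a' /\ s = s')
  (Hsurj : forall v, (v < dg_n D)%nat -> exists a s, used X a /\ vtx a s = v)
  (Hord : forall a s a' s', used X a -> used X a' -> (a, s) <> (a', s') ->
       ((vtx a s < vtx a' s')%nat <-> foot_before (foot m a s) (foot m a' s')))
  (Hedge : forall f b, X f -> signed_bump_of b f ->
       exists u v, sb_vtx vtx b false u /\ sb_vtx vtx b true v /\ In (u, v, lab f) (dg_edges D))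
  (Hlab : forall f g, X f -> X g -> lab f = lab g -> f = g)
  (Hhas : forall f, X f -> exists u v, In (u, v, lab f) (dg_edges D)).

Lemma used_marker a : used X a -> supt a (m a) /\ supt a (a (m a)) /\ m a < a (m a).
Proof.
  intros ha. pose proof (proj1 hm a ha) as h. destruct ha as [[hb hp] _].
  split; auto. split; [|apply hp; auto].
  intro e. apply h. apply (strict_increasing_inj a (proj1 (bump_line_homeo a hb))). auto.
Qed.

(** The signed bump of f is a or its inverse, and its edge runs from source to destination. As the
    source foot of a comes first, the direction of the edge tells which of the two it is. *)
Lemma used_signed_bump a f : pos_bump a -> X f ->
  (forall t, supt a t -> f t = a t) \/ (forall t, supt a t -> f t = inv a t) ->
  (vtx a false < vtx a true)%nat /\
  partner M (vtx a false) = vtx a true /\ partner M (vtx a true) = vtx a false /\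
  label M (vtx a false) = lab f /\ label M (vtx a true) = lab f /\
  forall t, left_end a <= t <= right_end a ->
    f t = (if rising M (vtx a false) then a t else inv a t).
Proof.
  intros ha hf hag.
  assert (hu : used X a) by (split; eauto).
  pose proof ha as [hb hp]. pose proof (bump_line_homeo a hb) as hl.
  pose proof (line_homeo_inv a hl) as hli.
  assert (hlt : (vtx a false < vtx a true)%nat).
  { apply Hord; auto; [congruence|]. intros u v [_ h1] [_ h2].
    destruct (used_marker a hu) as [_ [_ ?]]. lra. }
  split; auto.
  pose proof (supt_ends a hb) as hs.
  assert (hle : left_end a < right_end a).
  { destruct (used_marker a hu) as [h _]. apply hs in h. lra. }
  destruct hag as [hag|hag].
  - destruct (Hedge f a hf) as [u [v [h1 [h2 h3]]]]; [split; auto|].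
    destruct h1 as [[_ <-]|[h _]]; [|contradiction]. destruct h2 as [[_ <-]|[h _]]; [|contradiction].
    destruct (edge_data D hD _ _ _ h3) as [_ [_ [_ [e1 [e2 [e3 [e4 [e5 _]]]]]]]].
    unfold M. repeat (split; [assumption|]). intros t ht. rewrite e5.
    destruct (Nat.ltb_spec (vtx a false) (vtx a true)); [|lia].
    apply (continuity_agree_closure f a (left_end a) (right_end a)); auto.
    + apply line_homeo_continuity, homeo_line_homeo; auto.
    + apply line_homeo_continuity; auto.
    + intros s h. apply hag, hs; auto.
  - destruct (Hedge f (inv a) hf) as [u [v [h1 [h2 h3]]]].
    { split; [apply bump_inv; auto|]. intros t ht. apply hag. rewrite supt_inv in ht by auto. auto. }
    pose proof (pos_bump_inv_not_positive a ha) as hn.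
    destruct h1 as [[h _]|[_ <-]]; [contradiction|]. destruct h2 as [[h _]|[_ <-]]; [contradiction|].
    (* For an inverse bump the two feet change roles, so the edge goes from [vtx a true] to
       [vtx a false]. *)
    rewrite inv_inv in h3 by auto. simpl in h3.
    destruct (edge_data D hD _ _ _ h3) as [_ [_ [_ [e1 [e2 [e3 [e4 [_ e5]]]]]]]].
    unfold M. repeat (split; [assumption|]). intros t ht. rewrite e5.
    destruct (Nat.ltb_spec (vtx a true) (vtx a false)); [lia|].
    apply (continuity_agree_closure f (inv a) (left_end a) (right_end a)); auto.
    + apply line_homeo_continuity, homeo_line_homeo; auto.
    + apply line_homeo_continuity; auto.
    + intros s h. apply hag, hs; auto.
Qed.

Definition bump_at (v : nat) : R -> R :=
  epsilon (inhabits idf) (fun a => used X a /\ exists s, vtx a s = v).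
Definition is_src (v : nat) : bool := Nat.eqb (vtx (bump_at v) false) v.
Definition xl (v : nat) : R := let a := bump_at v in if is_src v then left_end a else a (m a).
Definition xr (v : nat) : R := let a := bump_at v in if is_src v then m a else right_end a.
Definition xE (v : nat) : R -> R := if is_src v then bump_at v else inv (bump_at v).
(** The default [idf] makes [F_off] true at labels carried by no element of [X]. *)
Definition xF (k : nat) : R -> R :=
  if excluded_middle_informative (exists f, X f /\ lab f = k) then
    epsilon (inhabits idf) (fun f => X f /\ lab f = k)
  else idf.

Lemma bump_at_vtx a s : used X a -> bump_at (vtx a s) = a.
Proof.
  intros ha. unfold bump_at.
  match goal with |- epsilon ?i ?P = _ => destruct (epsilon_spec i P) as [h [s' e]] end.
  - exists a. split; eauto.
  - apply (Hinj _ s' _ s); auto.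
Qed.

Lemma src_data a : used X a -> let v := vtx a false in
  xl v = left_end a /\ xr v = m a /\ xE v = a.
Proof.
  intros ha. simpl. unfold xl, xr, xE, is_src. rewrite bump_at_vtx by auto.
  rewrite Nat.eqb_refl. auto.
Qed.

Lemma dest_data a : used X a -> let v := vtx a true in
  xl v = a (m a) /\ xr v = right_end a /\ xE v = inv a.
Proof.
  intros ha. simpl. unfold xl, xr, xE, is_src. rewrite bump_at_vtx by auto.
  destruct (Nat.eqb_spec (vtx a false) (vtx a true)) as [e|]; auto.
  apply Hinj in e; auto. destruct e; discriminate.
Qed.

Lemma xF_lab f : X f -> xF (lab f) = f.
Proof.
  intros hf. unfold xF. destruct (excluded_middle_informative _) as [h|h].
  - pose proof (epsilon_spec (inhabits idf) _ h) as [h1 h2]. apply Hlab; auto.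
  - exfalso. apply h. eauto.
Qed.

Lemma opening_used v : opening M v ->
  exists a f, used X a /\ X f /\ v = vtx a false /\ partner M v = vtx a true /\ lab f = label M v /\
    forall t, left_end a <= t <= right_end a -> f t = (if rising M v then a t else inv a t).
Proof.
  intros [h1 h2]. destruct (Hsurj v h1) as [a [s [ha e]]].
  pose proof ha as [hp [f [hf hag]]].
  destruct (used_signed_bump a f hp hf hag) as [e0 [e1 [e2 [e3 [e4 e5]]]]].
  exists a, f. destruct s; subst v; [lia|]. auto 10.
Qed.

Lemma vertex_interval a s : used X a -> let v := vtx a s in
  xl v < xr v /\ 0 <= xl v /\ xr v <= 1 /\ forall t, xl v < t < xr v -> foot m a s t.
Proof.
  intros ha v. destruct (used_marker a ha) as [h1 [h2 h3]].
  pose proof ha as [[hb hp] _]. pose proof (supt_ends a hb) as hs.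
  apply hs in h1, h2.
  destruct (bump_line_homeo a hb) as [_ [_ h01]].
  assert (0 <= left_end a).
  { apply Rnot_lt_le. intro c. set (t := (left_end a + Rmin 0 (right_end a)) / 2).
    pose proof (Rmin_l 0 (right_end a)). pose proof (Rmin_r 0 (right_end a)).
    assert (left_end a < Rmin 0 (right_end a)) by (apply Rmin_glb_lt; lra).
    apply (proj2 (hs t)); [unfold t; lra|]. apply h01. unfold t. lra. }
  assert (right_end a <= 1).
  { apply Rnot_lt_le. intro c. set (t := (right_end a + Rmax 1 (left_end a)) / 2).
    pose proof (Rmax_l 1 (left_end a)). pose proof (Rmax_r 1 (left_end a)).
    assert (Rmax 1 (left_end a) < right_end a) by (apply Rmax_lub_lt; lra).
    apply (proj2 (hs t)); [unfold t; lra|]. apply h01. unfold t. lra. }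
  destruct s; subst v.
  - destruct (dest_data a ha) as [-> [-> _]]. split; [lra|split; [lra|split; [lra|]]].
    intros t ht. unfold foot. split; [apply hs|]; lra.
  - destruct (src_data a ha) as [-> [-> _]]. split; [lra|split; [lra|split; [lra|]]].
    intros t ht. unfold foot. split; [apply hs|]; lra.
Qed.

Lemma diagram_realizes : realizes M xl xr xE xF.
Proof.
  assert (hvert : forall v, (v < size M)%nat -> exists a s, used X a /\ vtx a s = v) by exact Hsurj.
  assert (hgenF : forall v, (v < size M)%nat -> exists f, X f /\ lab f = label M v).
  { intros v hv. destruct (opening_cases M v (matching_of_is_matching D hD) hv) as [ho|ho];
    destruct (opening_used _ ho) as [a [f [ha [hf [e1 [e2 [e3 e4]]]]]]]; exists f; split; auto.
    rewrite e3. apply label_partner; auto. apply (matching_of_is_matching D hD). }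
  constructor.
  - intros v hv. destruct (hvert v hv) as [a [s [ha <-]]]. apply (vertex_interval a s ha).
  - intros v w hvw hw. destruct (hvert v ltac:(lia)) as [a [s [ha <-]]].
    destruct (hvert w hw) as [b [s' [hb <-]]].
    destruct (vertex_interval a s ha) as [h1 [_ [_ h2]]].
    destruct (vertex_interval b s' hb) as [h3 [_ [_ h4]]].
    apply (interval_before (foot m a s) (foot m b s') (xl (vtx a s)) _ _ (xr (vtx b s'))); auto.
    apply Hord; auto. intro e. inversion e. subst. lia.
  - intros v hv. destruct (hvert v hv) as [a [s [ha <-]]]. apply (vertex_interval a s ha).
  - intros v hv. destruct (hvert v hv) as [a [s [ha <-]]]. apply (vertex_interval a s ha).
  - intros v hv. destruct (hvert v hv) as [a [s [ha <-]]].
    pose proof (bump_line_homeo a (proj1 (proj1 ha))) as hl. destruct s.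
    + destruct (dest_data a ha) as [_ [_ ->]]. apply line_homeo_inv; auto.
    + destruct (src_data a ha) as [_ [_ ->]]. auto.
  - intros v t hv. destruct (hvert v hv) as [a [s [ha <-]]].
    pose proof (bump_line_homeo a (proj1 (proj1 ha))) as hl.
    destruct (dest_data a ha) as [_ [_ e1]]. destruct (src_data a ha) as [_ [_ e2]].
    pose proof ha as [hp [f [hf hag]]].
    destruct (used_signed_bump a f hp hf hag) as [_ [e3 [e4 _]]]. destruct s.
    + rewrite e4, e1, e2. apply inv_right. exact (proj1 (proj2 hl)).
    + rewrite e3, e1, e2. apply inv_left. auto.
  - intros v hv. destruct (opening_used v hv) as [a [f [ha [hf [e1 [e2 _]]]]]].
    rewrite e2, e1. destruct (dest_data a ha) as [-> _]. destruct (src_data a ha) as [_ [-> ->]]. auto.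
  - intros v t hv ht. destruct (opening_used v hv) as [a [f [ha [hf [e1 [e2 _]]]]]].
    rewrite e2, e1 in *. destruct (dest_data a ha) as [_ [d1 _]]. rewrite d1 in ht.
    destruct (src_data a ha) as [d2 [_ d3]]. rewrite d2 in ht. rewrite d3.
    apply NNPP. intro h. apply ht. apply supt_ends; auto. apply ha.
  - intros v t hv ht. destruct (opening_used v hv) as [a [f [ha [hf [e1 [e2 _]]]]]].
    rewrite e2, e1 in *. destruct (dest_data a ha) as [_ [d1 _]]. rewrite d1 in ht.
    destruct (src_data a ha) as [d2 [_ d3]]. rewrite d2 in ht. rewrite d3.
    apply ha. apply supt_ends; auto. apply ha.
  - intros v hv. destruct (hgenF v hv) as [f [hf <-]]. rewrite xF_lab by auto.
    apply homeo_line_homeo; auto.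
  - intros v t hv ht. destruct (opening_used v hv) as [a [f [ha [hf [e1 [e2 [e3 e4]]]]]]].
    rewrite <- e3, xF_lab by auto. rewrite e2, e1 in ht |- *. rewrite e1 in e4.
    destruct (dest_data a ha) as [_ [d1 ->]]. rewrite d1 in ht.
    destruct (src_data a ha) as [d2 [_ ->]]. rewrite d2 in ht. auto.
  - intros k t h. unfold xF. destruct (excluded_middle_informative _) as [hk|]; auto.
    pose proof (epsilon_spec (inhabits idf) _ hk) as [h1 h2].
    set (f := epsilon _ _) in *. clearbody f. apply NNPP. intro hne.
    (* A moved point lies on a signed bump of f. That bump or its inverse is a positive bump used in
       [X], and its source is an opening vertex with label k whose orbital contains t. *)
    destruct (bump_through f t (homeo_line_homeo f (hX f h1)) hne) as [b [hb hbt]].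
    assert (exists a, pos_bump a /\ supt a t /\
      ((forall t, supt a t -> f t = a t) \/ (forall t, supt a t -> f t = inv a t)))
      as [a [ha [hat hag]]].
    { destruct hb as [hb hag]. pose proof (bump_line_homeo b hb) as hl.
      destruct (classic (positive b)) as [hp|hp].
      - exists b. split; [split; auto|auto].
      - exists (inv b). split; [apply bump_not_positive_inv; auto|].
        split; [apply supt_inv; auto|]. right. intros s hs. rewrite inv_inv by auto.
        apply hag. rewrite supt_inv in hs by auto. auto. }
    assert (hu : used X a) by (split; eauto).
    destruct (used_signed_bump a f ha h1 hag) as [e0 [e1 [e2 [e3 _]]]].
    apply (h (vtx a false)).
    + split; [apply Hlt; auto|]. rewrite e1. auto.
    + congruence.
    + rewrite e1. destruct (dest_data a hu) as [_ [-> _]]. destruct (src_data a hu) as [-> _].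
      apply supt_ends; auto. apply ha.
Qed.

(** Every element of [X] labels some edge, so it is the generator at the vertices of that edge;
    conversely each vertex carries a bump of some element of [X]. *)
Lemma diagram_generators f : X f <-> generators M xF f.
Proof.
  split.
  - intros hf. destruct (Hhas f hf) as [u [w he]].
    destruct (edge_data D hD _ _ _ he) as [h1 [_ [_ [_ [_ [h2 _]]]]]].
    exists u. split; auto. unfold M. rewrite h2. symmetry. apply xF_lab; auto.
  - intros [v [hv ->]].
    destruct (opening_cases M v (matching_of_is_matching D hD) hv) as [ho|ho];
    destruct (opening_used _ ho) as [a [f [ha [hf [e1 [e2 [e3 e4]]]]]]].
    + rewrite <- e3, xF_lab; auto.
    + rewrite label_partner in e3; [|apply (matching_of_is_matching D hD)|auto].
      rewrite <- e3, xF_lab; auto.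
Qed.

End FromDiagram.

Lemma diagram_iso_realizes D X : is_diagram D -> (forall f, X f -> homeo f) -> diagram_iso X D ->
  exists l r E F, realizes (matching_of D) l r E F /\ forall f, X f <-> generators (matching_of D) F f.
Proof.
  intros hD hX [m [hm [vtx [lab [H1 [H2 [H3 [H4 [H5 [H6 [H7 H8]]]]]]]]]]].
  exists (xl X m vtx), (xr X m vtx), (xE X vtx), (xF X lab). split.
  - apply diagram_realizes; auto.
  - apply (diagram_generators D hD X hX m hm vtx lab); auto.
Qed.

(** * The marked isomorphism *)

(** The list depends on the matching only, so it enumerates the generators of all realizations in
    corresponding order. *)
Definition first_vertices (M : matching) : list nat :=
  filter (fun v => forallb (fun w => negb (Nat.eqb (label M w) (label M v))) (seq 0 v)) (seq 0 (size M)).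

Lemma first_vertices_In M v : In v (first_vertices M) <-> (v < size M)%nat /\ first_with_label M v.
Proof.
  unfold first_vertices, first_with_label. rewrite filter_In, in_seq, forallb_forall.
  split; intros [h1 h2]; (split; [lia|]).
  - intros w hw e. specialize (h2 w). rewrite in_seq, e, Nat.eqb_refl in h2.
    specialize (h2 ltac:(lia)). discriminate.
  - intros w hw. rewrite in_seq in hw. specialize (h2 w ltac:(lia)).
    destruct (Nat.eqb_spec (label M w) (label M v)); auto; contradiction.
Qed.

Lemma filter_seq_increasing (P : nat -> bool) k n i j :
  (i < j)%nat -> (j < length (filter P (seq k n)))%nat ->
  (nth i (filter P (seq k n)) 0 < nth j (filter P (seq k n)) 0)%nat.
Proof.
  revert k i j. induction n as [|n IH]; intros k i j hij hj; simpl in *; [lia|].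
  destruct (P k).
  - simpl in hj. destruct j as [|j]; [lia|]. destruct i as [|i]; simpl.
    + assert (h : In (nth j (filter P (seq (S k) n)) 0%nat) (filter P (seq (S k) n))) by (apply nth_In; lia).
      rewrite filter_In, in_seq in h. lia.
    + apply IH; lia.
  - apply IH; auto.
Qed.

Lemma first_vertex_of_label M v : (v < size M)%nat ->
  exists w, In w (first_vertices M) /\ label M w = label M v.
Proof.
  induction v as [v IH] using lt_wf_ind. intros hv.
  destruct (classic (first_with_label M v)) as [h|h].
  - exists v. rewrite first_vertices_In. auto.
  - assert (exists w, (w < v)%nat /\ label M w = label M v) as [w [h1 h2]].
    { apply NNPP. intro no. apply h. intros w hw e. apply no. eauto. }
    destruct (IH w h1 ltac:(lia)) as [u [h3 h4]]. exists u. split; congruence.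
Qed.

(** Least transition points along the list are the values of [l], which increase with the vertex;
    their distinctness also rules out repeated generators. *)
Lemma enum_generators M l r E F : is_matching M -> realizes M l r E F ->
  enum_ltp (generators M F) (map (fun v => F (label M v)) (first_vertices M)).
Proof.
  intros hM hR.
  set (g := fun v => F (label M v)). set (vs := first_vertices M).
  assert (hnth : forall i, (i < length (map g vs))%nat -> nth i (map g vs) idf = g (nth i vs 0%nat)).
  { intros i hi. rewrite (nth_indep _ idf (g 0%nat) hi). apply map_nth. }
  assert (hinc : forall i j, (i < j)%nat -> (j < length (map g vs))%nat ->
    exists ti tj, least_tp (nth i (map g vs) idf) ti /\ least_tp (nth j (map g vs) idf) tj /\ ti < tj).
  { intros i j hij hj. rewrite !hnth by lia. rewrite length_map in hj.
    assert (hi : In (nth i vs 0%nat) vs) by (apply nth_In; lia).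
    assert (hj' : In (nth j vs 0%nat) vs) by (apply nth_In; lia).
    apply first_vertices_In in hi, hj'.
    exists (l (nth i vs 0%nat)), (l (nth j vs 0%nat)).
    split; [apply (least_tp_first M hM l r E F hR); tauto|].
    split; [apply (least_tp_first M hM l r E F hR); tauto|].
    apply (l_lt M l r E F hR); [|tauto]. apply filter_seq_increasing; auto. }
  split; [|split; auto].
  - intros f. rewrite in_map_iff. split.
    + intros [v [hv ->]]. destruct (first_vertex_of_label M v hv) as [w [h1 h2]].
      exists w. split; auto. unfold g. rewrite h2. auto.
    + intros [v [<- hv]]. apply first_vertices_In in hv. exists v. split; auto. tauto.
  - apply NoDup_nth with (d := idf).
    assert (hlt : forall i j, (i < j)%nat -> (j < length (map g vs))%nat ->
      nth i (map g vs) idf <> nth j (map g vs) idf).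
    { intros i j hij hj e. destruct (hinc i j hij hj) as [ti [tj [[h1 h2] [[h3 h4] h5]]]].
      rewrite e in h1. apply h4 in h1. lra. }
    intros i j hi hj e. destruct (lt_eq_lt_dec i j) as [[h|h]|h]; auto; exfalso.
    + apply (hlt i j h hj e).
    + apply (hlt j i h hi). auto.
Qed.

Section Marked.

Context (M : matching) (hM : is_matching M) (hsize : (0 < size M)%nat)
  (hsep : forall v w, opening M v -> opening M w -> label M v = label M w ->
    (v < w)%nat -> (partner M v < w)%nat)
  (l r : nat -> R) (E F : nat -> R -> R) (hR : realizes M l r E F).

Let X := generators M F.
Let Y := generators M (mF M).

Let hY : realizes M (mL M) (mQ M) (mE M) (mF M) := model_realizes M hM hsize hsep.

Lemma genX_line_homeo f : gen X f -> line_homeo f.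
Proof. apply gen_line_homeo. apply (generators_homeo M l r E F hR). Qed.

Lemma genY_line_homeo f : gen Y f -> line_homeo f.
Proof. apply gen_line_homeo. apply (generators_homeo M _ _ _ _ hY). Qed.

(** [rel f h] says that h is what f induces through th. Existence follows by induction on words and
    uniqueness from surjectivity of th, so phi is a function compatible with products. *)
Lemma marked_semiconjugacy : exists phi, marked_iso X Y phi /\
  exists theta, cont_mono_surj theta /\
    forall f x, gen X f -> inI x -> theta (f x) = phi f (theta x).
Proof.
  destruct (semiconjugacy_to_model M hM hsize hsep l r E F hR) as [th [h1 [h2 [h3 [h4 [h5 h6]]]]]].
  assert (hth0 : th 0 = 0).
  { destruct (h4 0%nat hsize) as [e _]. unfold mL in e. simpl in e. rewrite grid_0 in e.
    pose proof (h2 0 (l 0%nat) (foot_lb _ _ _ _ _ hR _ hsize)). pose proof (h3 0). lra. }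
  assert (hth1 : th 1 = 1).
  { assert (hl : (pred (size M) < size M)%nat) by lia.
    destruct (h4 _ hl) as [_ e].
    pose proof (h2 _ _ (foot_ub _ _ _ _ _ hR _ hl)).
    (* The last foot ends at 1: an extra cell after it would need its partner to be [size M], which
       is not a vertex. *)
    assert (e' : mQ M (pred (size M)) = 1).
    { rewrite <- (grid_top M hsize). unfold mQ. f_equal.
      assert (es : size M = S (pred (size M))) by lia. rewrite es at 2. simpl.
      destruct (Nat.eqb_spec (partner M (pred (size M))) (S (pred (size M)))) as [c|]; [|lia].
      pose proof (partner_lt M hM _ hl). lia. }
    pose proof (h3 1). lra. }
  assert (hsurj : forall y, inI y -> exists x, inI x /\ th x = y).
  { intros y hy. apply (intermediate_value th 0 1 y); [auto|lra|].
    rewrite hth0, hth1. exact hy. }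
  set (rel := fun f h => gen Y h /\ forall x, th (f x) = h (th x)).
  assert (hex : forall f, gen X f -> exists h, rel f h).
  { intros f hf. induction hf as [|f [v [hv ->]]|f hf [h [ha hb]]|f g hf [h [ha hb]] hg [k [hc hd]]].
    - exists idf. split; [apply gen_id|]. auto.
    - exists (mF M (label M v)). split; [apply gen_base; exists v; auto|]. intros x. apply h6.
    - exists (inv h). split; [apply gen_inv; auto|]. intros x.
      symmetry. apply inv_eq; [apply genY_line_homeo; auto|].
      rewrite <- hb. f_equal. apply inv_right. apply (genX_line_homeo f hf).
    - exists (mul h k). split; [apply gen_mul; auto|]. intros x. unfold mul. rewrite hd, hb. auto. }
  assert (huniq : forall f h k, rel f h -> rel f k -> h = k).
  { intros f h k [ha hb] [hc hd]. apply functional_extensionality. intros y.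
    destruct (classic (inI y)) as [hy|hy].
    - destruct (hsurj y hy) as [x [_ <-]]. rewrite <- hb, <- hd. auto.
    - destruct (genY_line_homeo h ha) as [_ [_ e1]]. destruct (genY_line_homeo k hc) as [_ [_ e2]].
      unfold inI in hy. rewrite e1, e2; auto; lra. }
  set (phi := fun f => epsilon (inhabits idf) (rel f)).
  assert (hphi : forall f, gen X f -> rel f (phi f)) by (intros f hf; apply epsilon_spec, hex; auto).
  assert (hphi_eq : forall f h, gen X f -> rel f h -> phi f = h).
  { intros f h hf hr. apply (huniq f); auto. }
  assert (hfaith : forall g, gen X g -> (forall t, th (g t) = th t) -> g = idf).
  { intros g hg hi. apply (gen_faithful M hM l r E F hR th (expand M)); auto.
    - intros v x y hv. apply expand_dist; auto.
    - intros v t hv ht. apply h5; auto. lra.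
    - intros v hv. destruct (h4 v hv) as [e1 e2]. pose proof (mL_lt_mQ M hsize v).
      pose proof (foot_lt _ _ _ _ _ hR v hv).
      (* The foot excludes [r v], so a point with the midpoint value is taken as the second
         witness. *)
      destruct (intermediate_value th (l v) (r v) ((mL M v + mQ M v) / 2)) as [t [ht et]];
        [auto|lra|lra|].
      exists (l v), t. split; [lra|]. split; [|lra].
      split; [lra|]. destruct (proj2 ht) as [|e]; auto. subst t. lra. }
  exists phi. split; [split; [split; [|split; [|split]]|]|].
  - intros f hf. apply hphi; auto.
  - intros f g hf hg e.
    destruct (hphi f hf) as [_ hf2]. destruct (hphi g hg) as [_ hg2].
    pose proof (genX_line_homeo g hg) as hgl. pose proof (genX_line_homeo f hf) as hfl.
    (* If f and g induce the same map, f followed by the inverse of g leaves th invariant, and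
       faithfulness applies. *)
    assert (hk : mul f (inv g) = idf).
    { apply hfaith; [apply gen_mul; [auto|apply gen_inv; auto]|]. intros t. unfold mul.
      pose proof (genY_line_homeo _ (proj1 (hphi g hg))) as hpl.
      apply (strict_increasing_inj (phi g) (proj1 hpl)).
      rewrite <- hg2, inv_right by apply hgl. rewrite hf2, e. auto. }
    apply functional_extensionality. intros t.
    assert (e' : inv g (f t) = t) by (change (mul f (inv g) t = t); rewrite hk; auto).
    rewrite <- e' at 2. symmetry. apply inv_right. apply hgl.
  - intros h hh.
    assert (exists f, gen X f /\ rel f h) as [f [ha hb]]; [|exists f; auto].
    induction hh as [|h [v [hv ->]]|h hh [f [ha [hb hc]]]|h k hh [f [ha [hb hc]]] hk [g [hd [he hf]]]].
    + exists idf. split; [apply gen_id|]. split; [apply gen_id|]. auto.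
    + exists (F (label M v)). split; [apply gen_base; exists v; auto|].
      split; [apply gen_base; exists v; auto|]. intros x; apply h6.
    + exists (inv f). split; [apply gen_inv; auto|]. split; [apply gen_inv; auto|].
      intros x. symmetry. apply inv_eq; [apply genY_line_homeo; auto|].
      rewrite <- hc. f_equal. apply inv_right. apply (genX_line_homeo f ha).
    + exists (mul f g). split; [apply gen_mul; auto|]. split; [apply gen_mul; auto|].
      intros x. unfold mul. rewrite hf, hc. auto.
  - intros f g hf hg. apply hphi_eq; [apply gen_mul; auto|].
    destruct (hphi f hf) as [ha hb]. destruct (hphi g hg) as [hc hd].
    split; [apply gen_mul; auto|]. intros x. unfold mul. rewrite hd, hb. auto.
  - exists (map (fun v => F (label M v)) (first_vertices M)),
      (map (fun v => mF M (label M v)) (first_vertices M)).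
    split; [apply (enum_generators M l r E F); auto|].
    split; [apply (enum_generators M _ _ _ _ hM hY)|].
    split; [rewrite !length_map; auto|]. intros i hi. rewrite length_map in hi.
    (* [map_nth] wants a default that is itself a value of the mapped function; the index is in
       range. *)
    rewrite (nth_indep _ idf (F (label M 0%nat))) by (rewrite length_map; auto).
    rewrite (nth_indep _ idf (mF M (label M 0%nat))) by (rewrite length_map; auto).
    rewrite (map_nth (fun v => F (label M v))), (map_nth (fun v => mF M (label M v))).
    assert (hv : In (nth i (first_vertices M) 0%nat) (first_vertices M)) by (apply nth_In; auto).
    apply first_vertices_In in hv. destruct hv as [hv _].
    apply hphi_eq; [apply gen_base; eexists; split; eauto|].
    split; [apply gen_base; eexists; split; eauto|]. intros x. apply h6.
  - exists th. split; [split; [|split; [|split]]|]; auto.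
    + intros x _. apply h3.
    + intros x _ eps he. rewrite continuityE in h1. destruct (h1 x eps he) as [d [hd Hd]].
      exists d. split; auto.
    + intros f x hf _. apply hphi; auto.
Qed.

End Marked.

(** * Empty sets of generators, and the theorem *)

Lemma geom_fast_empty : geom_fast (fun _ => False).
Proof.
  split; [split; intros ? ? ? []|].
  split; [intros a [h _]; exact h|]. split.
  - split; intros a b t [_ [f [[] _]]].
  - exists (fun _ => 0). split.
    + intros a [_ [f [[] _]]].
    + intros a b s s' [_ [f [[] _]]].
Qed.

Lemma marked_semiconjugacy_empty (X : (R -> R) -> Prop) : (forall f, ~ X f) ->
  exists phi, marked_iso X (fun _ => False) phi /\
  exists theta, cont_mono_surj theta /\
    forall f x, gen X f -> inI x -> theta (f x) = phi f (theta x).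
Proof.
  intros hX. exists (fun f => f).
  assert (hg : forall f, gen X f <-> gen (fun _ => False) f).
  { intros f. split; intros h; induction h;
      [apply gen_id|elim (hX f); auto|apply gen_inv; auto|apply gen_mul; auto|
       apply gen_id|contradiction|apply gen_inv; auto|apply gen_mul; auto]. }
  split; [split; [split; [|split; [|split]]|]|].
  - intros f. apply hg.
  - auto.
  - intros h hh. exists h. split; auto. apply hg; auto.
  - auto.
  - exists nil, nil.
    assert (he : forall Z : (R -> R) -> Prop, (forall f, ~ Z f) -> enum_ltp Z nil).
    { intros Z hZ. split; [intros f; split; [apply hZ|intros []]|]. split; [constructor|].
      intros i j _ hj. simpl in hj. lia. }
    split; [apply he; auto|]. split; [apply he; auto|]. split; auto.
  - exists (fun x => x). split; [split; [|split; [|split]]|]; auto.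
    + intros x _ eps he. exists eps. split; auto.
    + intros y hy. exists y. auto.
Qed.

Theorem theorem1p2 :
  forall D : diagram, is_diagram D ->
  exists XD : (R -> R) -> Prop,
    (forall g, XD g -> PL_homeo g) /\ geom_fast XD /\
    forall X : (R -> R) -> Prop,
      (forall f, X f -> homeo f) -> geom_fast X -> finite_tp X -> diagram_iso X D ->
      exists phi : (R -> R) -> (R -> R), marked_iso X XD phi /\
      exists theta : R -> R, cont_mono_surj theta /\
        forall f x, gen X f -> inI x -> theta (f x) = phi f (theta x).
Proof.
  intros D hD. set (M := matching_of D).
  pose proof (matching_of_is_matching D hD) as hM. fold M in hM.
  (* Without vertices there are no cells and [grid] would divide by 0; both groups are then
     trivial. *)
  destruct (Nat.eq_dec (size M) 0) as [h0|h0].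
  { exists (fun _ => False). split; [intros g []|]. split; [apply geom_fast_empty|].
    intros X hX _ _ hiso. destruct (diagram_iso_realizes D X hD hX hiso) as [l [r [E [F [_ hgen]]]]].
    apply marked_semiconjugacy_empty. intros f hf. apply hgen in hf. destruct hf as [v [hv _]].
    fold M in hv. lia. }
  destruct (classic (forall v w, opening M v -> opening M w -> label M v = label M w ->
    (v < w)%nat -> (partner M v < w)%nat)) as [hsep|hsep].
  - assert (hsize : (0 < size M)%nat) by lia.
    exists (generators M (mF M)). split; [|split].
    + intros g [v [hv ->]]. apply mF_PL; auto.
    + apply (geom_fast_generators M hM _ _ _ _ (model_realizes M hM hsize hsep)).
    + intros X hX _ _ hiso. destruct (diagram_iso_realizes D X hD hX hiso) as [l [r [E [F [hR hgen]]]]].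
      (* [marked_iso] depends on the predicate itself, so the pointwise equivalence is turned into
         an equality. *)
      assert (e : X = generators M F).
      { apply functional_extensionality. intros f.
        apply propositional_extensionality. apply hgen. }
      rewrite e. apply (marked_semiconjugacy M hM hsize hsep l r E F hR).
  - (* Two edges with the same label overlap, so nothing realizes [D]. *)
    exists (fun _ => False). split; [intros g []|]. split; [apply geom_fast_empty|].
    intros X hX _ _ hiso. exfalso. apply hsep.
    destruct (diagram_iso_realizes D X hD hX hiso) as [l [r [E [F [hR _]]]]].
    apply (same_label_disjoint M hM l r E F hR).
Qed.
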